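(* $$\lim_{c\to 0^+}HD(\mathrm{Exact}(c))=\lim_{c\to 0^+}HD(\mathrm{Exact}'(c))=1.$$ Consequently, $\lim_{t\to\infty}HD(k^{-1}(t))=1$ and $\lim_{t\to\infty}HD(k^{-1}(-\infty,t))=\lim_{t\to\infty}D(t)=1$.
   Context: $HD$ denotes Hausdorff dimension and $\mathbb N^*=\{1,2,3,\dots\}$. For $c>0$: $\mathrm{Exact}(c)$ is the set of $\alpha\in\mathbb R$ such that $|\alpha-\frac pq|<\frac{c}{q^2}$ for infinitely many $(p,q)\in\mathbb Z\times\mathbb N^*$ but, for every $\varepsilon>0$, $|\alpha-\frac pq|<\frac{c-\varepsilon}{q^2}$ has only a finite number of solutions $(p,q)\in\mathbb Z\times\mathbb N^*$. $\mathrm{Exact}'(c)$ is the set of $\alpha\in\mathbb R$ such that for every $\varepsilon>0$, $|\alpha-\frac pq|<\frac{c+\varepsilon}{q^2}$ for infinitely many $(p,q)\in\mathbb Z\times\mathbb N^*$, but $|\alpha-\frac pq|<\frac{c}{q^2}$ has only a finite number of solutions $(p,q)\in\mathbb Z\times\mathbb N^*$. For irrational $\alpha$, $k(\alpha):=\sup\{k>0 \mid |\alpha-\frac pq|<\frac{1}{kq^2} \text{ has infinitely many rational solutions } \frac pq\}\in(0,+\infty]$; $k^{-1}(t)=\{\alpha\in\mathbb R\setminus\mathbb Q: k(\alpha)=t\}$, $k^{-1}(-\infty,t)=\{\alpha\in\mathbb R\setminus\mathbb Q: k(\alpha)<t\}$, and $D(t):=HD(k^{-1}(-\infty,t))$.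 *)

(* Defs.v *)
From HB Require Import structures.
From mathcomp Require Import all_boot all_order all_algebra.
From mathcomp Require Import all_classical all_reals all_analysis.

Set Implicit Arguments.
Unset Strict Implicit.
Unset Printing Implicit Defensive.

Import Order.TTheory GRing.Theory Num.Theory.
Import numFieldNormedType.Exports.

Local Open Scope classical_set_scope.
Local Open Scope ring_scope.

Section HausdorffDimension.
Variable R : realType.
Implicit Types (A U : set R) (s delta : R).

(* [maxe 0] gives the empty set diameter 0; [ereal_sup set0] is -oo. *)
Definition diam U : \bar R :=
  maxe 0%E (ereal_sup [set `|x.1 - x.2|%:E | x in U `*` U]).

(* The empty set has weight 0 also for s = 0, where 0 `^ 0 = 1; thus covers by
   sequences include finite covers, and the measure with s = 0 counts points. *)
Definition hausdorff_weight s U : \bar R :=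
  if U == set0 then 0%E else poweR (diam U) s.

Definition delta_cover delta A (U : nat -> set R) : Prop :=
  A `<=` \bigcup_i U i /\ forall i, (diam (U i) <= delta%:E)%E.

Definition hausdorff_premeasure s delta A : \bar R :=
  ereal_inf [set (\sum_(0 <= i <oo) hausdorff_weight s (U i))%E |
             U in delta_cover delta A].

(* The premeasure is nonincreasing in delta, so the supremum is the limit as
   delta tends to 0. *)
Definition hausdorff_measure s A : \bar R :=
  ereal_sup [set hausdorff_premeasure s delta A |
             delta in [set delta | 0 < delta]].

Definition HD A : \bar R :=
  ereal_inf [set s%:E | s in [set s | 0 <= s /\ hausdorff_measure s A = 0%E]].

End HausdorffDimension.

Section DiophantineApproximation.
Variable R : realType.
Implicit Types (alpha c t : R).

Definition approx_pairs alpha c : set (int * nat) :=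
  [set pq | (0 < pq.2)%N /\
            `|alpha - pq.1%:~R / pq.2%:R| < c / pq.2%:R ^+ 2].

Definition Exact c : set R :=
  [set alpha | infinite_set (approx_pairs alpha c) /\
     forall eps, 0 < eps -> finite_set (approx_pairs alpha (c - eps))].

Definition Exact' c : set R :=
  [set alpha |
     (forall eps, 0 < eps -> infinite_set (approx_pairs alpha (c + eps))) /\
     finite_set (approx_pairs alpha c)].

(* Solutions are counted as rational numbers p/q, in any representation. *)
Definition approx_rationals alpha c : set rat :=
  [set pq.1%:~R / pq.2%:R | pq in approx_pairs alpha c].

Definition kconst alpha : \bar R :=
  ereal_sup [set k%:E | k in
    [set k : R | 0 < k /\ infinite_set (approx_rationals alpha k^-1)]].

Definition k_level t : set R :=
  [set alpha | irrational alpha /\ kconst alpha = t%:E].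

Definition k_sublevel t : set R :=
  [set alpha | irrational alpha /\ (kconst alpha < t%:E)%E].

Definition D t : \bar R := HD (k_sublevel t).

End DiophantineApproximation.

(* Main.v *)
Require Import Defs.
From mathcomp Require Import all_boot all_order all_algebra.
From mathcomp Require Import all_classical all_reals all_analysis.
From mathcomp Require Import ring lra zify.
Set Implicit Arguments.
Unset Strict Implicit.
Unset Printing Implicit Defensive.
Import Order.TTheory GRing.Theory Num.Theory.
Import numFieldNormedType.Exports.
Local Open Scope classical_set_scope.
Local Open Scope ring_scope.

(** Every set of reals has dimension at most 1 ([HD_le1]).  Moreover [Exact c]
    is contained in [k_level c^-1] for c > 0, and [k_level s] in [k_sublevel t] for
    s < t, so everything follows once, for each m > 0, the sets [Exact c] and
    [Exact' c] are shown to have dimension at least m / (m + 1) for all small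
    enough c > 0 ([HD_Exact_ge]).

    Lower bounds on dimension.  If g : [0, 1[ -> A satisfies
    |u - v|^(m+1) <= C |g u - g v|^m, then a cover of A pulls back to a cover
    of [0, 1[, whose Lebesgue measure is 1; hence HD A >= m / (m + 1)
    ([HD_ge_ratio]).

    Badly approximable numbers.  Put err x p q = q |q x - p|.  An interval of
    length l is cut into N = 2 B + 3 equal parts, of which B + 1 pairwise
    non-adjacent ones are retained.  The rationals with q^2 between k / l and
    k N / l that come too close to the interval all coincide
    ([one_dangerous]), and such a rational spoils at most one of the retained
    parts ([one_zone]).  So B good children remain at each stage, at mutual
    distance at least l / N.  With B = 6^m one has N < 6 B, which leaves room
    for dimension m / (m + 1).  The map g follows the base B digits of u down
    this tree.

    Prescribing the constant c.  At sparse stages an interval is replaced by a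
    tiny one around p/q + c/q^2, for a suitable p/q, in which err x p q is as
    close to c as desired (on the wanted side) while every other new rational
    r/t has err x r t >= c ([insertion]).  To find p/q, write
    1/c = (1/c - y) + y with both summands badly approximable with a constant
    independent of c ([bad_pair]), and choose a basis (p, q), (p', q') of Z^2
    with p/q in the interval and q'/q close to y.  If x > p/q,
    yM = q'/q, T = 1 / err x p q and r/t is any fraction, then for some
    integers u and v

        err x r t = |u - v yM| |u - v yM + v T| / T.

    The vector (r, t) = (p, q) corresponds to (u, v) = (1, 0).  When v <> 0 is
    not too large, both factors are at least const / |v| because yM is close
    to y and T - yM to 1/c - y, while the larger one is at least |v| T / 2; so
    the quotient is at least const / 2, which exceeds c when c is small
    ([form_lower]).  When v is large, either t is beyond the range considered
    at this stage, or the quotient is bounded below directly, or t is so small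
    that a badly approximable point of the interval settles the matter
    ([special_lower]).

    The insertions are scheduled so rarely that the lengths at level n stay
    above const 6^(-(m+1)n) ([schedule]), and so do not affect the dimension.
    Requiring c - 2 eta <= err x p q <= c - eta at the inserted fractions
    gives points of [Exact c]; requiring c <= err x p q <= c + eta gives
    points of [Exact' c]. *)

(** * Hausdorff dimension on the line *)

Section Hausdorff.
Variable R : realType.
Implicit Types (A U : set R) (s : R).

Lemma diam_ge0 U : (0 <= diam U)%E.
Proof. by rewrite /diam le_max lexx. Qed.

Lemma diam_le U (l : R) : 0 <= l ->
  (forall x y, U x -> U y -> `|x - y| <= l) -> (diam U <= l%:E)%E.
Proof.
move=> l0 Ul; rewrite /diam ge_max lee_fin l0 /=.
by apply: ge_ereal_sup => _ [[x y] [/= Ux Uy] <-]; rewrite lee_fin; exact: Ul.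
Qed.

Lemma dist_le_diam U x y : U x -> U y -> (`|x - y|%:E <= diam U)%E.
Proof.
move=> Ux Uy; rewrite /diam le_max; apply/orP; right.
by apply: ereal_sup_ubound; exists (x, y).
Qed.

Lemma hausdorff_weight_ge0 s U : (0 <= hausdorff_weight s U)%E.
Proof. by rewrite /hausdorff_weight; case: ifP => // _; exact: poweR_ge0. Qed.

Lemma HD_mono A B : A `<=` B -> (HD A <= HD B)%E.
Proof.
move=> AB; apply: ereal_inf_le_tmp => _ [s [s0 HB] <-]; exists s => //.
split=> //; apply/eqP; rewrite eq_le; apply/andP; split.
  rewrite -HB; apply: ge_ereal_sup => _ [d d0 <-].
  apply: (@le_trans _ _ (hausdorff_premeasure s d B)); last first.
    by apply: ereal_sup_ubound; exists d.
  apply: ereal_inf_le_tmp => _ [U [BU Ud] <-]; exists U => //; split=> //.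
  exact: subset_trans BU.
apply: (@le_trans _ _ (hausdorff_premeasure s 1 A)).
  apply: le_ereal_inf_tmp => _ [U _ <-]; apply: nneseries_ge0 => i _ _.
  exact: hausdorff_weight_ge0.
by apply: ereal_sup_ubound; exists 1 => //=.
Qed.

(** By Cauchy condensation: the dyadic blocks are dominated by a geometric
    series of ratio 2^(1-s). *)
Lemma sum_riemannR_bounded s : 1 < s ->
  exists2 C : R, 0 < C & forall n, \sum_(0 <= i < n) riemannR s i <= C.
Proof.
move=> s1; set z : R := 2 `^ (1 - s).
have z0 : 0 < z by rewrite powR_gt0.
have z1 : z < 1.
  rewrite /z /powR pnatr_eq0 /= -[ltRHS]expR0 ltr_expR.
  by rewrite nmulr_rlt0 ?subr_lt0// ln_gt0// ltr1n.
exists (1 / (1 - z)); first by rewrite divr_gt0// subr_gt0.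
have s0 : 0 <= s by rewrite ltW// (lt_trans ltr01).
have dyadic n : \sum_(0 <= i < (2 ^ n).-1) riemannR s i <=
    series (geometric 1 z) n.
  elim: n => [|n IH]; first by rewrite expn0 /= big_geq// /series /= big_geq.
  have p0 : (0 < 2 ^ n)%N by rewrite expn_gt0.
  have le2 : ((2 ^ n).-1 <= (2 ^ n.+1).-1)%N by rewrite expnS; lia.
  rewrite (big_cat_nat (leq0n _) le2)//= /series /= big_nat_recr//= lerD//.
  have -> : 1 * z ^+ n = ((2 ^ n)%:R * ((2 ^ n)%:R `^ s)^-1 : R).
    rewrite mul1r /z -powR_mulrn ?powR_ge0// -powRrM.
    rewrite -powRN natrX -powR_mulrn// -powRrM -powRD; last first.
      by apply/implyP => _; rewrite pnatr_eq0.
    by congr (2 `^ _); ring.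
  apply: le_trans (_ : \sum_((2 ^ n).-1 <= i < (2 ^ n.+1).-1)
      ((2 ^ n)%:R `^ s)^-1 <= _).
    rewrite big_nat [leRHS]big_nat; apply: ler_sum => i /andP[i1 i2].
    rewrite lef_pV2 ?posrE ?powR_gt0 ?ltr0n//.
    apply: ge0_ler_powR => //; rewrite ?nnegrE ?ler0n// ler_nat; lia.
  rewrite sumr_const_nat.
  have -> : ((2 ^ n.+1).-1 - (2 ^ n).-1 = 2 ^ n)%N by rewrite expnS; lia.
  by rewrite mulr_natl.
move=> n.
apply: le_trans (_ : \sum_(0 <= i < (2 ^ n.+1).-1) riemannR s i <= _).
  have le2 : (n <= (2 ^ n.+1).-1)%N by have := ltn_expl n.+1 (ltnSn 1); lia.
  rewrite [leRHS](big_cat_nat (leq0n _) le2)//= lerDl sumr_ge0// => i _.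
  exact/ltW/riemannR_gt0.
apply: le_trans (dyadic _) _; apply: geometric_le_lim => //.
by rewrite gtr0_norm.
Qed.

(** Intervals of lengths t, t, t/2, t/2, t/3, t/3, ..., placed end to end
    alternately on both sides of 0, cover the line, and their s-th powers have
    a small sum when s > 1 and t is small. *)
Lemma HD_le1 A : (HD A <= 1)%E.
Proof.
apply/lee_addgt0Pr => e e0; rewrite -EFinD.
set s := 1 + e; have s1 : 1 < s by rewrite /s; lra.
have s0 : 0 <= s by lra.
apply: ereal_inf_lbound; exists s => //; split=> //.
have [C C0 HC] := sum_riemannR_bounded s1.
have pos d : (0 <= hausdorff_premeasure s d A)%E.
  apply: le_ereal_inf_tmp => _ [U _ <-]; apply: nneseries_ge0 => i _ _.
  exact: hausdorff_weight_ge0.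
apply/eqP; rewrite eq_le; apply/andP; split; last first.
  apply: (le_trans (pos 1)); apply: ereal_sup_ubound; exists 1 => //=.
apply: ge_ereal_sup => _ [d /= d0 <-]; apply/lee_addgt0Pr => e' e'0.
rewrite add0e.
pose t : R := Num.min (Num.min 1 d) (e' / C) / 2.
have m0 : 0 < Num.min (Num.min 1 d) (e' / C).
  by rewrite !lt_min ltr01 d0 divr_gt0.
have t0 : 0 < t by rewrite divr_gt0.
have : 2 * t <= Num.min (Num.min 1 d) (e' / C) by rewrite /t mulrC divfK.
rewrite !le_min -andbA => /and3P[t1 td te].
clearbody t.
(* U i is the interval of number i/2 on the side given by the parity of i *)
pose h n : R := series harmonic n.
pose sg (i : nat) : R := (-1) ^+ odd i.
pose U i : set R := [set x | t * h i./2 <= sg i * x <= t * h i./2.+1].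
have nsg i : `|sg i| = 1 by rewrite /sg normr_sign.
have hS n : h n.+1 = h n + n.+1%:R^-1.
  by rewrite /h /series /= big_nat_recr.
have half_bound i : (i.+1 <= 2 * i./2.+1)%N.
  by rewrite mul2n doubleS -{1}[i]odd_double_half; case: odd; rewrite ?add1n ?add0n.
have dU i : (diam (U i) <= (2 * t * i.+1%:R^-1)%:E)%E.
  apply: diam_le; first by rewrite mulr_ge0 ?invr_ge0 ?ler0n//; lra.
  move=> x y /andP[x1 x2] /andP[y1 y2].
  have -> : `|x - y| = `|sg i * x - sg i * y|.
    by rewrite -mulrBr normrM nsg mul1r.
  apply: (@le_trans _ _ (t * i./2.+1%:R^-1)).
    move: x1 x2 y1 y2; rewrite hS mulrDr ler_norml.
    move: (sg i * x) (sg i * y) (t * h _) (t / _) => x' y' u v x1 x2 y1 y2.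
    by apply/andP; split; lra.
  rewrite ler_pdivrMr ?ltr0n// mulrAC ler_pdivlMr ?ltr0n//.
  by rewrite (mulrC 2) -mulrA ler_pM2l// -natrM ler_nat half_bound.
have cov : A `<=` \bigcup_i U i.
  move=> x _.
  have [b xb] : exists b : bool, 0 <= (-1) ^+ b * x.
    case: (leP 0 x) => x0; [exists false|exists true].
      by rewrite expr0 mul1r.
    by rewrite expr1 mulN1r oppr_ge0 ltW.
  set y := (-1) ^+ b * x in xb.
  have [n hn] : exists n, y < t * h n.
    apply: contrapT => /forallNP hN; apply: (@dvg_harmonic R).
    apply: nondecreasing_is_cvgn.
      apply/nondecreasing_seqP => n; rewrite -/(h n.+1) hS lerDl.
      by rewrite invr_ge0 ler0n.
    exists (y / t) => _ [n _ <-]; rewrite ler_pdivlMr// mulrC.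
    by rewrite leNgt; apply/negP; exact: hN.
  have [k kn hk] : exists2 k, t * h k <= y & y < t * h k.+1.
    elim: n hn => [|n IH] hn; first by rewrite /h /series /= big_geq// in hn; lra.
    by case: (leP (t * h n) y) => [?|/IH//]; exists n.
  exists (b + k.*2)%N => //; rewrite /U /=.
  rewrite half_bit_double /sg oddD odd_double addbF oddb -/y.
  by rewrite kn ltW.
apply: ge_ereal_inf.
exists (\sum_(0 <= i <oo) hausdorff_weight s (U i))%E.
  exists U => //; split=> // i; apply: (le_trans (dU i)); rewrite lee_fin.
  apply: le_trans td; rewrite ler_piMr//; first by lra.
  by rewrite invf_le1 ?ltr0n// ler1n.
apply: lime_le.
  by apply: is_cvg_nneseries => i _ _; exact: hausdorff_weight_ge0.
apply: nearW => n.
apply: (@le_trans _ _ (\sum_(0 <= i < n) (2 * t * riemannR s i)%:E)%E).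
  apply: lee_sum => i _; rewrite /hausdorff_weight; case: ifP => _.
    by rewrite lee_fin mulr_ge0 ?mulr_ge0 ?(ltW t0)// ltW// riemannR_gt0.
  apply: (@le_trans _ _ ((2 * t * i.+1%:R^-1)%:E `^ s)%E).
    apply: gt0_ler_poweR; rewrite ?in_itv /= ?leey ?andbT ?diam_ge0//.
    by rewrite lee_fin mulr_ge0 ?invr_ge0 ?ler0n//; lra.
  rewrite poweR_EFin lee_fin powRM ?invr_ge0 ?ler0n//; last by lra.
  have -> : (i.+1%:R^-1 `^ s = riemannR s i :> R).
    by rewrite /riemannR -powR_inv1 ?ler0n// powRAC powR_inv1 ?powR_ge0.
  rewrite ler_wpM2r//; first by rewrite ltW// riemannR_gt0.
  by apply: ge1r_powR; [apply/andP; split; lra|exact: ltW].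
rewrite sumEFin lee_fin -mulr_sumr.
apply: (@le_trans _ _ (2 * t * C)); first by rewrite ler_pM2l//; lra.
by rewrite -ler_pdivlMr.
Qed.

(** A cover of A by sets of diameter D_i <= 1 pulls back along g to a cover of
    [0, 1[ by sets of diameter at most C D_i^s, hence by intervals of total
    length at most 2 C times the s'-weight of the cover, for all s' < s. *)
Lemma HD_ge (A : set R) (g : R -> R) (C s : R) : 0 < C ->
  (forall u, 0 <= u < 1 -> A (g u)) ->
  (forall u v, 0 <= u < 1 -> 0 <= v < 1 ->
     `|u - v| <= C * `|g u - g v| `^ s) ->
  (s%:E <= HD A)%E.
Proof.
move=> C0 gA gC; apply: le_ereal_inf_tmp => _ [s' [s'0 Hs'] <-].
rewrite lee_fin leNgt; apply/negP => ss'.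
suff : ((2 * C)^-1%:E <= hausdorff_premeasure s' 1 A)%E.
  have : (hausdorff_premeasure s' 1 A <= 0)%E.
    by rewrite -Hs'; apply: ereal_sup_ubound; exists 1 => //=.
  move=> H1 /le_trans /(_ H1); rewrite lee_fin leNgt invr_gt0 mulr_gt0//.
apply: le_ereal_inf_tmp => _ [U [AU Ud] <-].
pose V i := [set u : R | 0 <= u < 1 /\ U i (g u)].
have cover i : exists K : set R, [/\ measurable K, V i `<=` K &
    (lebesgue_measure K <= (2 * C)%:E * hausdorff_weight s' (U i))%E].
  have C20 : 0 < 2 * C by rewrite mulr_gt0.
  case: (pselect (exists u, V i u)) => [[u [u01 Uu]]|noV]; last first.
    exists set0; split=> //; first by move=> u Vu; apply: noV; exists u.
    by rewrite measure0 mule_ge0 ?hausdorff_weight_ge0// lee_fin ltW.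
  have := Ud i; have := diam_ge0 (U i); have := @dist_le_diam (U i).
  rewrite /hausdorff_weight; case: ifP => [/eqP U0|_]; first by rewrite U0 in Uu.
  case: (diam (U i)) => [D| |]//.
  rewrite !lee_fin => dD D0 D1.
  exists `[u - C * D `^ s', u + C * D `^ s']%classic; split.
  - exact: measurable_itv.
  - move=> v [v01 Uv] /=; rewrite in_itv /=.
    have : `|u - v| <= C * D `^ s'.
      apply: (le_trans (gC _ _ u01 v01)); rewrite ler_pM2l//.
      apply: (@le_trans _ _ (D `^ s)).
        apply: ge0_ler_powR; rewrite ?nnegrE//; first by rewrite ltW// (le_lt_trans s'0).
        by have := dD _ _ Uu Uv; rewrite lee_fin.
      have [->|Dn0] := eqVneq D 0.
        by rewrite powR0 ?powR_ge0// gt_eqF// (le_lt_trans s'0).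
      by apply: ger_powR (ltW ss'); rewrite D1 andbT lt_def Dn0.
    by rewrite ler_norml => /andP[? ?]; apply/andP; split; lra.
  - rewrite lebesgue_measure_itv /=; case: ifP => _.
      by rewrite -EFinD -EFinM lee_fin; lra.
    by rewrite mule_ge0// ?lee_fin ?powR_ge0 ?ltW.
have [J HJ] := choice cover.
have : (1%:E <= (2 * C)%:E * \sum_(0 <= i <oo) hausdorff_weight s' (U i))%E.
  rewrite -nneseriesZl; last by move=> i _; exact: hausdorff_weight_ge0.
  have -> : 1%:E = lebesgue_measure (`[0, 1[%classic : set R).
    by rewrite lebesgue_measure_itv /= lte_fin ltr01 sube0.
  apply: (@le_trans _ _ (\sum_(0 <= i <oo) lebesgue_measure (J i))%E).
    apply: measure_sigma_subadditive => //.
      by move=> i; have [] := HJ i.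
    move=> u /=; rewrite in_itv /= => u01.
    have [i _ Ui] := AU _ (gA _ u01); exists i => //.
    by have [_ + _] := HJ i; apply.
  by apply: lee_nneseries => i; [|have [] := HJ i].
have C20 : 0 < 2 * C by rewrite mulr_gt0.
by rewrite -lee_pdivrMl// mule1.
Qed.

Lemma HD_ge_ratio (A : set R) (g : R -> R) (C : R) (m : nat) : 0 < C ->
  (forall u, 0 <= u < 1 -> A (g u)) ->
  (forall u v, 0 <= u < 1 -> 0 <= v < 1 ->
     `|u - v| ^+ m.+1 <= C * `|g u - g v| ^+ m) ->
  ((m%:R / m.+1%:R)%:E <= HD A)%E.
Proof.
move=> C0 gA gC; apply: (@HD_ge A g (C `^ m.+1%:R^-1)) => //.
  exact: powR_gt0.
move=> u v u01 v01; have := gC _ _ u01 v01.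
have i0 : 0 <= m.+1%:R^-1 :> R by rewrite invr_ge0 ler0n.
move=> /(ge0_ler_powR i0); rewrite !nnegrE exprn_ge0// mulr_ge0 ?exprn_ge0// ?(ltW C0)//.
move=> /(_ isT isT); rewrite powRM ?exprn_ge0 ?(ltW C0)//.
by rewrite -!powR_mulrn// -!powRrM divff ?pnatr_eq0// powRr1.
Qed.

End Hausdorff.

(** * Badly approximable numbers *)

Section BadlyApproximable.
Variable R : realType.

Lemma nested_intervals (a l : nat -> R) :
  (forall n, 0 <= l n) ->
  (forall n, a n <= a n.+1 /\ a n.+1 + l n.+1 <= a n + l n) ->
  exists x, forall n, a n <= x <= a n + l n.
Proof.
move=> l0 nest.
have am n m : a n <= a (m + n)%N.
  by elim: m => [//|m IH]; apply: (le_trans IH); rewrite addSn; case: (nest (m + n)%N).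
have bm n m : a (m + n)%N + l (m + n)%N <= a n + l n.
  by elim: m => [//|m IH]; apply: le_trans IH; rewrite addSn; case: (nest (m + n)%N).
have ab n m : a n <= a m + l m.
  case: (leqP n m) => [nm|/ltnW mn].
    by rewrite -(subnK nm); apply: (le_trans (am n (m - n)%N)); rewrite lerDl.
  by have := bm m (n - m)%N; rewrite subnK// => H; apply: le_trans H; rewrite lerDl.
have ubd m : ubound (range a) (a m + l m) by move=> _ [n _ <-]; exact: ab.
exists (sup (range a)) => n; apply/andP; split.
  by apply: ub_le_sup; [exists (a 0%N + l 0%N); exact: ubd|exists n].
by apply: ge_sup; [exists (a 0%N); exists 0%N|exact: ubd].
Qed.

(** Normalized quality of the approximation p/q of x, that is
    q^2 |x - p/q| when q > 0 ([errE]). *)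
Definition err (x : R) (p q : int) : R := q%:~R * `|q%:~R * x - p%:~R|.

Lemma frac_sep (p q p' q' : int) : 0 < q -> 0 < q' ->
  (p%:~R / q%:~R : R) != p'%:~R / q'%:~R ->
  1 <= q%:~R * q'%:~R * `|p%:~R / q%:~R - p'%:~R / q'%:~R : R|.
Proof.
move=> q0 q'0 neq.
have Q0 : 0 < q%:~R :> R by rewrite ltr0z.
have Q'0 : 0 < q'%:~R :> R by rewrite ltr0z.
rewrite -{1}(gtr0_norm (mulr_gt0 Q0 Q'0)) -normrM.
have -> : q%:~R * q'%:~R * (p%:~R / q%:~R - p'%:~R / q'%:~R) =
    (p * q' - p' * q)%:~R :> R.
  by rewrite rmorphB /= !rmorphM /=; field; rewrite !gt_eqF.
rewrite -intr_norm ler1z -gtz0_ge1 normr_gt0.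
apply: contra_neq neq => /eqP; rewrite subr_eq0 => /eqP e.
have n0 : q%:~R != 0 :> R by rewrite gt_eqF.
have n'0 : q'%:~R != 0 :> R by rewrite gt_eqF.
apply: (mulIf n0); apply: (mulIf n'0).
by rewrite divfK// -intrM e intrM mulrAC divfK.
Qed.

Lemma errE x p q : 0 < q -> err x p q = q%:~R ^+ 2 * `|x - p%:~R / q%:~R|.
Proof.
move=> q0; have Q0 : 0 < q%:~R :> R by rewrite ltr0z.
rewrite /err expr2 -mulrA; congr (_ * _).
rewrite -{2}(gtr0_norm Q0) -normrM; congr `|_|.
by field; rewrite gt_eqF.
Qed.

(** In an interval of length l, all the rationals p/q with
    k/l <= q^2 < k N / l that are too close to some point of the interval are
    equal to a single number z: two distinct ones would be at distance at
    least 1 / (q q') > 2 l. *)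
Lemma one_dangerous (N : nat) (k a l : R) : (0 < N)%N -> 0 < l -> 0 < k ->
  k <= (2 * N%:R)^-1 ->
  exists z : R, forall x, a <= x <= a + l -> forall p q : int, 0 < q ->
    k <= q%:~R ^+ 2 * l -> q%:~R ^+ 2 * l < k * N%:R ->
    l / (2 * N%:R) <= `|x - z| -> k / (2 * N%:R) <= err x p q.
Proof.
move=> N0 l0 k0 kN; have N0' : 0 < N%:R :> R by rewrite ltr0n.
pose bad (pq : int * int) := exists2 x, a <= x <= a + l &
  [/\ 0 < pq.2, k <= pq.2%:~R ^+ 2 * l, pq.2%:~R ^+ 2 * l < k * N%:R &
      err x pq.1 pq.2 < k / (2 * N%:R)].
case: (pselect (exists pq, bad pq)) => [|nobad]; last first.
  exists 0 => x xI p q q0 q1 q2 _; rewrite leNgt; apply/negP => e.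
  by apply: nobad; exists (p, q); exists x.
move=> [[p' q'] [x' /andP[x'1 x'2] /= [q'0 q'1 q'2 e']]].
exists (p'%:~R / q'%:~R) => x /andP[x1 x2] p q q0 q1 q2 far.
rewrite leNgt; apply/negP => e.
have Q0 : 0 < q%:~R :> R by rewrite ltr0z.
have Q'0 : 0 < q'%:~R :> R by rewrite ltr0z.
have close y (r s : int) : 0 < s -> k <= s%:~R ^+ 2 * l ->
    err y r s < k / (2 * N%:R) -> `|y - r%:~R / s%:~R| < l / (2 * N%:R).
  move=> s0 s1; rewrite errE// => er.
  have S0 : 0 < s%:~R ^+ 2 :> R by rewrite exprn_gt0// ltr0z.
  rewrite -(ltr_pM2l S0); apply: (lt_le_trans er).
  by rewrite mulrA ler_wpM2r// invr_ge0 mulr_ge0.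
have c1 := close _ _ _ q0 q1 e; have c2 := close _ _ _ q'0 q'1 e'.
have [E|neq] := eqVneq (p%:~R / q%:~R : R) (p'%:~R / q'%:~R).
  by move: far; rewrite -E leNgt c1.
have sep := frac_sep q0 q'0 neq.
set z := p%:~R / q%:~R in c1 sep; set z' := p'%:~R / q'%:~R in c2 sep.
clearbody z z'.
have lN : l / (2 * N%:R) <= l / 2.
  rewrite ler_pM2l// lef_pV2 ?posrE ?mulr_gt0// ler_peMr// ler1n//.
have dz : `|z - z'| < 2 * l.
  move: c1 c2; rewrite !ltr_norml => /andP[? ?] /andP[? ?].
  by apply/andP; split; lra.
have qq : q%:~R * q'%:~R * l < k * N%:R.
  rewrite -(@ltr_pXn2r _ 2) ?nnegrE ?mulr_ge0 ?(ltW Q0) ?(ltW Q'0) ?(ltW l0) ?(ltW k0)//.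
  have -> : (q%:~R * q'%:~R * l) ^+ 2 = (q%:~R ^+ 2 * l) * (q'%:~R ^+ 2 * l) by ring.
  rewrite [ltRHS]expr2; apply: ltr_pM => //; rewrite mulr_ge0 ?exprn_ge0 ?(ltW Q0) ?(ltW Q'0) ?(ltW l0)//.
have kN' : k * N%:R <= 2^-1.
  by move: kN; rewrite invfM -ler_pdivlMr ?invr_gt0// invrK.
have : q%:~R * q'%:~R * `|z - z'| < 1.
  apply: (@le_lt_trans _ _ (q%:~R * q'%:~R * (2 * l))).
    by rewrite ler_pM2l ?mulr_gt0// ltW.
  lra.
by rewrite ltNge sep.
Qed.

(** Among the intervals [a + (2j+1)w, a + (2j+2)w], at most one meets the open
    interval of length w centred at z. *)
Lemma one_zone (w a z : R) : 0 < w ->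
  exists e : nat, forall j : nat, j != e -> forall x,
    a + (2 * j%:R + 1) * w <= x <= a + (2 * j%:R + 2) * w -> w / 2 <= `|x - z|.
Proof.
move=> w0.
pose hit (j : nat) := (2 * j%:R + 2^-1) * w < z - a < (2 * j%:R + 5 / 2) * w.
case: (pselect (exists j, hit j)) => [[e he]|nohit].
  exists e => j je x /andP[x1 x2].
  have {je}[je|je] : (j + 1 <= e)%N \/ (e + 1 <= j)%N by move/eqP: je; lia.
    have : (j%:R + 1 <= e%:R :> R) by rewrite natr1 -addn1 ler_nat.
    move=> /(ler_wpM2r (ltW w0)) H; move: he => /andP[h1 h2].
    rewrite ler0_norm; lra.
  have : (e%:R + 1 <= j%:R :> R) by rewrite natr1 -addn1 ler_nat.
  move=> /(ler_wpM2r (ltW w0)) H; move: he => /andP[h1 h2].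
  rewrite ger0_norm; lra.
exists 0%N => j _ x /andP[x1 x2].
case: (leP (z - a) ((2 * j%:R + 2^-1) * w)) => [h|h].
  rewrite ger0_norm; lra.
case: (leP ((2 * j%:R + 5 / 2) * w) (z - a)) => [h'|h'].
  rewrite ler0_norm; lra.
by exfalso; apply: nohit; exists j; rewrite /hit h h'.
Qed.

(** Dirichlet's approximation theorem, by the pigeonhole principle. *)
Lemma dirichlet (x : R) (Q : nat) : (0 < Q)%N ->
  exists p q : int, [/\ 0 < q, q <= Q & `|q%:~R * x - p%:~R| < Q%:R^-1].
Proof.
move=> Q0; have Q0' : 0 < Q%:R :> R by rewrite ltr0n.
pose fr (i : nat) : R := i%:R * x - (Num.floor (i%:R * x))%:~R.
have fr0 i : 0 <= fr i by rewrite subr_ge0 floor_le.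
have fr1 i : fr i < 1.
  by rewrite ltrBlDr addrC -[X in _ + X]/(1%:~R) -intrD floorD1_gt.
have tr i : (Num.trunc (Q%:R * fr i) < Q)%N.
  by rewrite truncn_lt_nat ?mulr_ge0 ?(ltW Q0')// gtr_pMr.
pose f (i : 'I_Q.+1) : 'I_Q := Ordinal (tr i).
have /injectivePn [i [j ij fij]] : ~~ injectiveb f.
  apply/negP => /injectiveP /leq_card; rewrite !card_ord ltnn//.
wlog lij : i j ij fij / (i < j)%N.
  move=> wl; have [/wl|/wl|/val_inj/eqP] := ltngtP i j; [exact| |by rewrite (negbTE ij)].
  by apply; rewrite 1?eq_sym.
exists (Num.floor (j%:R * x) - Num.floor (i%:R * x)), (j%:Z - i%:Z).
have jQ := ltn_ord j.
split; [lia|lia|].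
have -> : (j%:Z - i%:Z)%:~R * x -
    (Num.floor (j%:R * x) - Num.floor (i%:R * x))%:~R = fr j - fr i.
  by rewrite /fr !intrB -!pmulrn; ring.
have e : Num.trunc (Q%:R * fr i) = Num.trunc (Q%:R * fr j).
  by move/(congr1 val): fij.
have /andP[a1 a2] := truncn_itv (mulr_ge0 (ltW Q0') (fr0 i)).
have /andP[b1 b2] := truncn_itv (mulr_ge0 (ltW Q0') (fr0 j)).
rewrite e in a1 a2; rewrite -(ltr_pM2l Q0') divff ?gt_eqF//.
rewrite -{1}(gtr0_norm Q0') -normrM mulrBr ltr_norml.
move: a1 a2 b1 b2; rewrite -natr1; move: (Num.trunc _)%:R => n.
move=> *; apply/andP; split; lra.
Qed.

(** A Dirichlet approximation, in lowest terms, is completed into a basis of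
    Z^2 whose second denominator is comparable to the first. *)
Lemma dirichlet_basis (x : R) (Q : nat) : (0 < Q)%N ->
  exists p q p' q' : int, [/\ 0 < q, q <= Q, `|q%:~R * x - p%:~R| < Q%:R^-1,
    p * q' - p' * q = 1 & q <= q' < 2 * q].
Proof.
move=> Q0; have [p1 [q1 [q10 q1Q H]]] := dirichlet x Q0.
set g := gcdz p1 q1.
have g0 : 0 < g.
  by rewrite lt_def gcdz_eq0 negb_and (gt_eqF q10) orbT.
have [p pE] : exists p, p1 = p * g by apply/dvdzP; exact: dvdz_gcdl.
have [q qE] : exists q, q1 = q * g by apply/dvdzP; exact: dvdz_gcdr.
have q0 : 0 < q by rewrite -(pmulr_lgt0 _ g0) -qE.
have [u [v uv]] : exists u v, u * p + v * q = 1.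
  have [u [v uv]] := Bezoutz p1 q1; exists u, v.
  apply: (mulIf (negbT (gt_eqF g0))); rewrite mul1r.
  by transitivity (u * p1 + v * q1); [rewrite pE qE; ring|].
have g1 : 1 <= g by rewrite -gtz0_ge1.
exists p, q, (- v + p * (1 - (u %/ q)%Z)), (u + (1 - (u %/ q)%Z) * q); split => //.
- by apply: le_trans q1Q; rewrite qE ler_peMr ?(ltW q0).
- apply: le_lt_trans H; rewrite qE pE !intrM mulrAC -mulrBl normrM.
  by rewrite ler_peMr// ger0_norm ?ler1z// ler0z ltW.
- by rewrite -uv; ring.
- have := divz_eq u q; have := modz_ge0 u (negbT (gt_eqF q0)).
  have := ltz_pmod u q0; move: (u %% q)%Z (u %/ q)%Z => r k ? ? ->.
  apply/andP; split; lia.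
Qed.

Lemma halving_small (l : nat -> R) : (forall n, 0 <= l n) ->
  (forall n, l n.+1 <= l n / 2) -> forall e, 0 < e -> exists n, l n < e.
Proof.
move=> l0 lS e e0.
have H n : l n * 2 ^+ n <= l 0%N.
  elim: n => [|n IH]; first by rewrite expr0 mulr1.
  apply: le_trans IH; rewrite exprS mulrA ler_wpM2r ?exprn_ge0//.
  by rewrite -ler_pdivlMr.
pose n := Num.trunc (l 0%N / e).
exists n.+1; have n2 : (n.+1%:R <= 2 ^+ n.+1 :> R).
  by rewrite -natrX ler_nat ltnW// ltn_expl.
have := H n.+1; apply: contraTT; rewrite -leNgt -ltNge => en.
have : l 0%N / e < n.+1%:R by have /andP[] := truncn_itv (divr_ge0 (l0 0%N) (ltW e0)).
rewrite ltr_pdivrMr// => /lt_le_trans; apply; rewrite mulrC.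
by apply: ler_pM => //; exact: ltW.
Qed.

(** A sequence starting above k and reaching below k has a step across k. *)
Lemma crossing (f : nat -> R) (k : R) m : k <= f 0%N -> f m < k ->
  exists n, k <= f n /\ f n.+1 < k.
Proof.
move=> f0; elim: m => [|m IH] fm; first by move: fm; rewrite ltNge f0.
by case: (leP k (f m)) => [?|/IH//]; exists m.
Qed.

(** In any interval of length l there is an x such that both x and t - x are
    badly approximable by rationals with q^2 >= k / l.  Each division into N
    parts leaves three candidates (j = 0, 1, 2), of which the dangerous
    rationals for x and for t - x eliminate at most one each.  None of the
    candidates is the first or the last part, so x stays at distance l / N
    from the ends. *)
Lemma bad_point (B : nat) (k t a l : R) : (1 < B)%N -> 0 < l -> 0 < k ->
  let N : R := (2 * B + 3)%N%:R in k <= (2 * N)^-1 ->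
  exists2 x : R, a + l / N <= x <= a + l - l / N &
    forall p q : int, 0 < q -> k <= q%:~R ^+ 2 * l ->
      k / (2 * N) <= err x p q /\ k / (2 * N) <= err (t - x) p q.
Proof.
move=> B1 l0 k0 N kN.
have N7 : 7 <= N by rewrite /N ler_nat; lia.
have N0 : 0 < N by lra.
have N0n : (0 < 2 * B + 3)%N by lia.
have N1 : N^-1 < 1 by rewrite invf_lt1//; lra.
have step a' l' : 0 < l' -> exists j : nat, [/\ (j <= 2)%N & forall x,
    a' + (2 * j%:R + 1) * (l' / N) <= x <= a' + (2 * j%:R + 2) * (l' / N) ->
    forall p q : int, 0 < q -> k <= q%:~R ^+ 2 * l' -> q%:~R ^+ 2 * l' < k * N ->
    k / (2 * N) <= err x p q /\ k / (2 * N) <= err (t - x) p q].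
  move=> l'0.
  have [z Hz] := one_dangerous a' N0n l'0 k0 kN.
  have [z' Hz'] := one_dangerous (t - a' - l') N0n l'0 k0 kN.
  have w0 : 0 < l' / N by rewrite divr_gt0.
  have [e He] := one_zone a' z w0.
  have [e' He'] := one_zone a' (t - z') w0.
  have [j [j2 je je']] : exists j, [/\ (j <= 2)%N, j != e & j != e'].
    case: (eqVneq 0%N e) => [<-|h0]; [case: (eqVneq 1%N e') => [<-|h1]|].
    - by exists 2%N.
    - by exists 1%N.
    case: (eqVneq 0%N e') => [<-|h1]; last by exists 0%N.
    case: (eqVneq 1%N e) => [<-|h2]; first by exists 2%N.
    by exists 1%N.
  exists j; split => // x xI p q q0 q1 q2.
  have wE : l' / (2 * N) = l' / N / 2 by rewrite invfM; ring.
  have j2' : j%:R <= 2 :> R by rewrite (ler_nat _ _ 2).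
  have j0 : 0 <= j%:R :> R by rewrite ler0n.
  have xI' : a' <= x <= a' + l'.
    move: xI => /andP[x1 x2].
    have lE : l' = N * (l' / N) by rewrite mulrC divfK ?gt_eqF.
    have := mulr_ge0 j0 (ltW w0).
    have := ler_wpM2r (ltW w0) j2'; have := ler_wpM2r (ltW w0) N7.
    rewrite -lE => *; apply/andP; split; lra.
  split.
    by apply: (Hz x xI') => //; rewrite wE; exact: (He j).
  apply: (Hz' (t - x)) => //.
    by move: xI' => /andP[? ?]; apply/andP; split; lra.
  rewrite wE; have := He' j je' x xI.
  by rewrite -normrN; congr (_ <= `|_|); ring.
have step' (al : R * R) : exists j : nat, 0 < al.2 -> (j <= 2)%N /\ forall x,
    al.1 + (2 * j%:R + 1) * (al.2 / N) <= x <= al.1 + (2 * j%:R + 2) * (al.2 / N) ->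
    forall p q : int, 0 < q -> k <= q%:~R ^+ 2 * al.2 -> q%:~R ^+ 2 * al.2 < k * N ->
    k / (2 * N) <= err x p q /\ k / (2 * N) <= err (t - x) p q.
  case: (pselect (0 < al.2)) => [h|h]; last by exists 0%N.
  by have [j [? ?]] := step al.1 al.2 h; exists j.
have [f fP] := choice step'.
(* iterate, coding an interval by its left end and its length *)
pose nxt (al : R * R) := (al.1 + (2 * (f al)%:R + 1) * (al.2 / N), al.2 / N).
pose al n := iter n nxt (a, l).
have alS n : al n.+1 = nxt (al n) by [].
have lpos n : 0 < (al n).2.
  by elim: n => [//|n IH]; rewrite alS /nxt /= divr_gt0.
have sub n : (al n).1 + (al n).2 / N <= (al n.+1).1 /\
    (al n.+1).1 + (al n.+1).2 <= (al n).1 + (al n).2 - (al n).2 / N.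
  rewrite alS /nxt /=; have [f2 _] := fP _ (lpos n).
  have w0 : 0 < (al n).2 / N by rewrite divr_gt0.
  have lE : (al n).2 = N * ((al n).2 / N) by rewrite mulrC divfK ?gt_eqF.
  have j0 : 0 <= (f (al n))%:R :> R by rewrite ler0n.
  have j2' : (f (al n))%:R <= 2 :> R by rewrite (ler_nat _ _ 2).
  have := mulr_ge0 j0 (ltW w0).
  have := ler_wpM2r (ltW w0) j2'; have := ler_wpM2r (ltW w0) N7.
  rewrite -lE => *; split; lra.
have [x xI] : exists x, forall n, (al n).1 <= x <= (al n).1 + (al n).2.
  apply: nested_intervals => n; first exact: ltW.
  have [s1 s2] := sub n; have w0 : 0 < (al n).2 / N by rewrite divr_gt0.
  split; lra.
exists x.
  have /andP[x1 x2] := xI 1%N; have /= [s1 s2] := sub 0%N.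
  apply/andP; split; [exact: le_trans x1|exact: le_trans s2].
move=> p q q0 q1.
have Q0 : 0 < q%:~R ^+ 2 :> R by rewrite exprn_gt0// ltr0z.
have [m Hm] : exists m, q%:~R ^+ 2 * (al m).2 < k.
  have [m Hm] : exists m, (al m).2 < k / q%:~R ^+ 2.
    apply: (@halving_small (fun n => (al n).2)) => [n|n|]; first exact: ltW.
      rewrite alS /nxt /= ler_pM2l// lef_pV2 ?posrE//; lra.
    by rewrite divr_gt0.
  by exists m; rewrite mulrC -ltr_pdivlMr.
have [n [n1 n2]] := @crossing (fun n => q%:~R ^+ 2 * (al n).2) k m q1 Hm.
have [_ H] := fP _ (lpos n); apply: H => //.
  have := xI n.+1; rewrite alS /nxt /=.
  by move=> /andP[? ?]; apply/andP; split; lra.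
by move: n2; rewrite alS /nxt /= mulrA ltr_pdivrMr.
Qed.

End BadlyApproximable.

(** * Inserting one rational with prescribed approximation quality *)

Section LinearForms.
Variable R : realType.

(** Number of parts into which an interval is divided, with [B] children. *)
Definition Nb (B : nat) : R := (2 * B + 3)%N%:R.
(** Constant of badness for the two summands y and 1/c - y. *)
Definition bad0 (B : nat) : R := (2 * Nb B)^-1 / (2 * Nb B).
(** An interval of length l is thought of as resolving the rationals with
    q^2 l < kap B.  The factor 384 is what makes the range of denominators
    covered by the badness of y, of constant [bad0], reach the scale of the
    interval produced by an insertion (see [special_lower]). *)
Definition kap (B : nat) : R := bad0 B / 384.
(** Constant of badness obtained by subdividing at scale [kap]. *)
Definition bad1 (B : nat) : R := kap B / (2 * Nb B).

(** x is badly approximable with constant c0; denominators may be negative. *)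
Definition badly (c0 x : R) := forall u v : int, v != 0 ->
  c0 <= `|v%:~R| * `|v%:~R * x - u%:~R|.

(** Lower bound for the form |u - v yM| |u - v yM + v T|, for (yM, T) near
    (y, t) and v not too large: both factors are at least c0 / (2 |v|), and
    the larger one is at least |v| T / 2. *)
Lemma form_lower (c0 y yM t T a : R) (u v : int) :
  0 < c0 -> 0 < a -> badly c0 y -> badly c0 (t - y) ->
  `|yM - y| <= 2 / a ^+ 2 -> `|T - t| <= 1 / a ^+ 2 -> 0 < T -> v != 0 ->
  v%:~R ^+ 2 <= c0 * a ^+ 2 / 6 ->
  c0 * T / 4 <= `|u%:~R - v%:~R * yM| * `|u%:~R - v%:~R * yM + v%:~R * T|.
Proof.
move=> c00 a0 by_ bx dy dT T0 v0 v2.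
have V0 : 0 < `|v%:~R| :> R by rewrite normr_gt0 intr_eq0.
set V := `|v%:~R| in V0 *.
have VV : V ^+ 2 = v%:~R ^+ 2 by rewrite /V real_normK ?num_real.
have a20 : 0 < a ^+ 2 by rewrite exprn_gt0.
have small k e : `|e| <= k / a ^+ 2 -> V * `|v%:~R * e| <= k * c0 / 6.
  move=> he; rewrite normrM -/V mulrA -expr2 VV.
  have := ler_pM (sqr_ge0 _) (normr_ge0 _) v2 he.
  move/le_trans; apply; rewrite le_eqVlt; apply/orP; left; apply/eqP; field.
  by rewrite gt_eqF.
set X := `|u%:~R - v%:~R * yM|; set Y := `|_ + _|.
have hX : c0 / 2 <= V * X.
  have h1 := by_ u v v0; have h2 := small _ _ dy.
  have : `|v%:~R * y - u%:~R| <= X + `|v%:~R * (yM - y)|.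
    rewrite distrC; have -> : u%:~R - v%:~R * y =
      (u%:~R - v%:~R * yM) + v%:~R * (yM - y) by ring.
    exact: ler_normD.
  move/(ler_wpM2l (ltW V0)); rewrite -/V in h1; rewrite mulrDr; lra.
have hY : c0 / 2 <= V * Y.
  have h1 := bx (- u) v v0; have h2 := small _ _ dy; have h3 := small _ _ dT.
  have : `|v%:~R * (t - y) - (- u)%:~R| <=
      Y + `|v%:~R * (yM - y)| + `|v%:~R * (T - t)|.
    have -> : v%:~R * (t - y) - (- u)%:~R =
      (u%:~R - v%:~R * yM + v%:~R * T) + v%:~R * (yM - y) - v%:~R * (T - t).
      by rewrite intrN; ring.
    apply: (le_trans (ler_normB _ _)); rewrite lerD2r; exact: ler_normD.
  move/(ler_wpM2l (ltW V0)); rewrite -/V in h1; lra.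
have hVT : V * T <= X + Y.
  have -> : V * T = `|v%:~R * T| by rewrite normrM (gtr0_norm T0).
  have -> : v%:~R * T = (u%:~R - v%:~R * yM + v%:~R * T) - (u%:~R - v%:~R * yM) by ring.
  by rewrite (addrC X); exact: ler_normB.
have X0 : 0 <= X by exact: normr_ge0.
have Y0 : 0 <= Y by exact: normr_ge0.
rewrite -(ler_pM2l V0).
case: (leP (V * T / 2) X) => h.
  have -> : V * (X * Y) = X * (V * Y) by ring.
  have := ler_pM (ltW (divr_gt0 (mulr_gt0 V0 T0) (ltr0n _ 2))) (ltW (divr_gt0 c00 (ltr0n _ 2))) h hY.
  by apply: le_trans; rewrite le_eqVlt; apply/orP; left; apply/eqP; field.
have h' : V * T / 2 <= Y by lra.
have -> : V * (X * Y) = Y * (V * X) by ring.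
have := ler_pM (ltW (divr_gt0 (mulr_gt0 V0 T0) (ltr0n _ 2))) (ltW (divr_gt0 c00 (ltr0n _ 2))) h' hX.
by apply: le_trans; rewrite le_eqVlt; apply/orP; left; apply/eqP; field.
Qed.

Lemma int_ge2 (u : int) : 0 < u -> u != 1 -> 2 <= u.
Proof. by lia. Qed.

(** If (a, b), (a', b') is a basis of Z^2, then a nonnegative combination
    of the slopes b/a and b'/a' stays within 1 / a^2 of b/a. *)
Lemma comb_close (a b a' b' m m' : int) : 0 < a -> a <= a' ->
  b * a' - b' * a = 1 -> 0 <= m -> 0 < m' ->
  `|(m * b + m' * b')%:~R / (m * a + m' * a')%:~R - b%:~R / a%:~R| <=
    1 / a%:~R ^+ 2 :> R.
Proof.
move=> a0 aa' det m0 m'0.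
have A0 : 0 < a%:~R :> R by rewrite ltr0z.
have M' : 0 < m'%:~R :> R by rewrite ltr0z.
have qa : m'%:~R * a%:~R <= (m * a + m' * a')%:~R :> R.
  rewrite intrD !intrM -[leLHS]add0r lerD ?mulr_ge0 ?ler0z ?(ltW a0)//.
  by rewrite ler_pM2l// ler_int.
have Q0 : 0 < (m * a + m' * a')%:~R :> R.
  by apply: lt_le_trans qa; rewrite mulr_gt0.
have -> : (m * b + m' * b')%:~R / (m * a + m' * a')%:~R - b%:~R / a%:~R =
    - (m'%:~R / (a%:~R * (m * a + m' * a')%:~R)) :> R.
  have E : a%:~R * (m * b + m' * b')%:~R - b%:~R * (m * a + m' * a')%:~R =
      - m'%:~R :> R.
    rewrite -!intrM -intrB -intrN; congr (_%:~R).
    rewrite -[m' in RHS]mulr1 -det; ring.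
  rewrite -[m'%:~R]opprK -E; move: Q0.
  move: (m * b + _)%:~R (m * a + _)%:~R => P Q Q0.
  by field; rewrite !gt_eqF.
rewrite normrN ger0_norm; last by rewrite divr_ge0 ?mulr_ge0 ?ltW.
rewrite ler_pdivrMr ?mulr_gt0// mul1r expr2 invfM mulrACA mulVf ?gt_eqF// mul1r.
by rewrite mulrC ler_pdivlMr.
Qed.

(** If al0 and p/q are within 1 / q0^2 of p0/q0, then so is, up to a
    constant, any point al slightly to the right of p/q. *)
Lemma special_close (p q p0 q0 al0 al s : R) :
  0 < q0 -> q0 <= q -> `|p / q - p0 / q0| <= 1 / q0 ^+ 2 ->
  `|al0 - p0 / q0| <= 1 / q0 ^+ 2 ->
  s = q * (q * al - p) -> 0 <= s <= 1 -> `|al - al0| <= 3 / q0 ^+ 2.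
Proof.
move=> Q00 q_geq0 e2 e3 sE /andP[s0 s1].
have Qpos : 0 < q by exact: lt_le_trans q_geq0.
have e1 : `|al - p / q| <= 1 / q0 ^+ 2.
  have -> : al - p / q = s / q ^+ 2 by rewrite sE; field; rewrite gt_eqF.
  rewrite ger0_norm; last by rewrite divr_ge0// sqr_ge0.
  apply: ler_pM; rewrite ?invr_ge0 ?sqr_ge0//.
  by rewrite lef_pV2 ?posrE ?exprn_gt0// ler_pXn2r// nnegrE ltW.
have -> : al - al0 = (al - p / q) + (p / q - p0 / q0) - (al0 - p0 / q0) by ring.
apply: (le_trans (ler_normB _ _)).
have := ler_normD (al - p / q) (p / q - p0 / q0); lra.
Qed.

(** The heart of the insertion: for a point al with err al p q = s close to c,
    all the other rationals r/t with denominators between the scale of the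
    original interval (length l) and that of the new one (length
    eta / q^2) have err at least c.  In terms of v = p t - r q:
    - if v = 0 then r/t is a multiple (u p, u q), of err u^2 s;
    - for v^2 <= c0 a^2 / 6, [form_lower] applies;
    - for larger v, either t is so large that r/t is beyond the new scale, or
      t / q times |v| is bounded below, or t is so small compared with q0 that
      the badness of the nearby al0 suffices. *)
Lemma special_lower (c0 c1 k1 c y : R) (a : R) (q0 : R)
    (al0 l : R) (p q p' q' : int) (eta al s : R) :
  0 < c1 -> c1 <= c0 -> k1 = c0 / 384 -> 0 < c -> c <= c1 / 60 ->
  badly c0 y -> badly c0 (c^-1 - y) -> 1 <= a -> 0 < q0 ->
  (forall p q : int, 0 < q -> k1 <= q%:~R ^+ 2 * l -> c1 <= err al0 p q) ->
  0 < q -> p * q' - p' * q = - 1 -> q%:~R <= 5 * (q0 * a) ->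
  `|q'%:~R / q%:~R - y| <= 2 / a ^+ 2 ->
  eta = c ^+ 2 / (4 * a ^+ 2) -> s = q%:~R * (q%:~R * al - p%:~R) ->
  c / 2 <= s <= 2 * c -> `|c - s| <= 2 * eta -> `|al - al0| <= 3 / q0 ^+ 2 ->
  forall r t : int, 0 < t -> k1 <= t%:~R ^+ 2 * l ->
    t%:~R ^+ 2 * (eta / q%:~R ^+ 2) < k1 -> (r = p /\ t = q) \/ c <= err al r t.
Proof.
move=> c10 c01 k1E cpos cle bady badx A0 Q00 bad_al0 q_gt0 detP q_le dy etaE sE.
move=> /andP[s_ge s_le] dcs close r t t0 t1 t2.
have c02 : c0 > 0 by exact: lt_le_trans c01.
have A1 : 0 < a by exact: lt_le_trans A0.
have s_gt0 : 0 < s by apply: lt_le_trans s_ge; rewrite divr_gt0.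
have Q02 : 0 < q0 ^+ 2 by rewrite exprn_gt0.
have Qpos : 0 < q%:~R :> R by rewrite ltr0z.
have T0 : 0 < t%:~R :> R by rewrite ltr0z.
(* u and v are the coordinates of (r, t) in the basis, up to sign *)
pose v := p * t - r * q; pose u := p' * t - r * q'.
have tE : t = u * q - v * q'.
  transitivity (- (- 1) * t); first by rewrite opprK mul1r.
  by rewrite -detP /u /v; ring.
pose rho : R := t%:~R / q%:~R.
have rho0 : 0 < rho by rewrite divr_gt0.
pose yM : R := q'%:~R / q%:~R.
have rhoE : rho = u%:~R - v%:~R * yM.
  by rewrite /rho /yM {1}tE intrB !intrM; field; rewrite gt_eqF.
have errr : err al r t = rho * `|rho * s + v%:~R|.
  rewrite /err -{1}(divfK (negbT (gt_eqF Qpos)) t%:~R) -/rho -mulrA; congr (_ * _).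
  rewrite -{1}(gtr0_norm Qpos) -normrM; congr `|_|.
  rewrite sE /rho /v intrB !intrM; field; by rewrite gt_eqF.
have rho2 : rho ^+ 2 * q%:~R ^+ 2 = t%:~R ^+ 2.
  by rewrite -exprMn /rho divfK// gt_eqF.
clearbody rho.
have [v0|v0] := eqVneq v 0.
  have uE : t = u * q by rewrite {1}tE v0 mul0r subr0.
  have u0 : 0 < u by rewrite -(pmulr_lgt0 _ q_gt0) -uE.
  rewrite v0 mul0r subr0 in rhoE.
  have [u1|u1] := eqVneq u 1.
    left; rewrite u1 mul1r in uE; split=> //; apply/eqP.
    by move: v0; rewrite /v uE -mulrBl => /eqP; rewrite mulf_eq0 (gt_eqF q_gt0) orbF subr_eq0 eq_sym.
  right; have u2 : 2 <= u%:~R :> R by rewrite (ler_int _ 2) int_ge2.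
  rewrite errr v0 addr0 ger0_norm ?mulr_ge0 ?(ltW rho0) ?(ltW s_gt0)// rhoE mulrA.
  have : 2 * 2 <= u%:~R * u%:~R :> R by apply: ler_pM => //.
  move=> /(ler_wpM2r (ltW s_gt0)); lra.
right.
have V0 : 0 < `|v%:~R| :> R by rewrite normr_gt0 intr_eq0.
have VV : `|v%:~R| ^+ 2 = v%:~R ^+ 2 :> R by rewrite real_normK ?num_real.
have A20 : 0 < a ^+ 2 by rewrite exprn_gt0.
case: (leP (v%:~R ^+ 2) (c0 * a ^+ 2 / 6)) => v2.
  have dT : `|s^-1 - c^-1| <= 1 / a ^+ 2.
    have -> : s^-1 - c^-1 = (c - s) / (c * s).
      by field; rewrite !gt_eqF.
    rewrite normrM normfV (gtr0_norm (mulr_gt0 cpos s_gt0)) ler_pdivrMr ?mulr_gt0//.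
    apply: (le_trans dcs).
    have -> : 2 * eta = 1 / a ^+ 2 * (c * (c / 2)).
      by rewrite etaE; field; rewrite gt_eqF.
    by rewrite ler_pM2l ?divr_gt0// ler_pM2l.
  have := form_lower u c02 A1 bady badx dy dT _ v0 v2.
  rewrite invr_gt0 => /(_ s_gt0); rewrite -rhoE.
  move=> /(ler_wpM2l (ltW s_gt0)).
  have -> : s * (c0 / s / 4) = c0 / 4 by field; rewrite gt_eqF.
  have -> : s * (`|rho| * `|rho + v%:~R / s|) = err al r t.
    rewrite errr (gtr0_norm rho0) mulrCA; congr (_ * _).
    rewrite -{1}(gtr0_norm s_gt0) -normrM; congr `|_|; field.
    by rewrite gt_eqF.
  lra.
case: (leP `|rho * s + v%:~R| (`|v%:~R| / 2)) => big.
  (* rho is at least |v| T / 2, so t is beyond the new scale *)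
  have h1 : `|v%:~R| / 2 <= rho * s.
    have := ler_normB (rho * s + v%:~R) (rho * s).
    rewrite addrAC subrr add0r (gtr0_norm (mulr_gt0 rho0 s_gt0)); lra.
  have h2 : v%:~R ^+ 2 / 4 <= rho ^+ 2 * (2 * c) ^+ 2.
    have -> : v%:~R ^+ 2 / 4 = (`|v%:~R| / 2) ^+ 2 :> R by rewrite -VV; field.
    rewrite -exprMn ler_pXn2r ?nnegrE ?divr_ge0 ?mulr_ge0 ?normr_ge0 ?(ltW rho0) ?(ltW cpos)//.
    by apply: (le_trans h1); rewrite ler_pM2l.
  exfalso; move: t2; rewrite ltNge => /negP; apply.
  rewrite -rho2 etaE.
  have -> : rho ^+ 2 * q%:~R ^+ 2 * (c ^+ 2 / (4 * a ^+ 2) / q%:~R ^+ 2) =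
     rho ^+ 2 * (2 * c) ^+ 2 / (16 * a ^+ 2).
    by field; rewrite !gt_eqF.
  rewrite ler_pdivlMr; last by lra.
  apply: le_trans h2; rewrite k1E; lra.
(* 1/6 is such that t^2 |al - al0| <= c1 / 2 when t^2 <= (c1/6) q0^2 *)
case: (leP (c1 / 6 * q0 ^+ 2) (t%:~R ^+ 2)) => tq0.
  have h1 : rho * `|v%:~R| / 2 <= err al r t.
    by rewrite errr -mulrA ler_pM2l// ltW.
  apply: le_trans h1.
  have h2 : (c1 / 30) ^+ 2 <= (rho * `|v%:~R|) ^+ 2.
    have -> : (rho * `|v%:~R|) ^+ 2 = rho ^+ 2 * v%:~R ^+ 2 :> R by rewrite -VV; ring.
    have h3 : c1 / 6 / (25 * a ^+ 2) <= rho ^+ 2.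
      rewrite ler_pdivrMr; last by lra.
      rewrite -(ler_pM2r Q02); apply: (le_trans tq0); rewrite -rho2.
      have -> : rho ^+ 2 * (25 * a ^+ 2) * q0 ^+ 2 = rho ^+ 2 * (5 * (q0 * a)) ^+ 2.
        by ring.
      rewrite ler_wpM2l ?sqr_ge0// ler_pXn2r// nnegrE ?(ltW Qpos)//.
      by rewrite !mulr_ge0// ltW.
    have h4 : 0 <= c1 / 6 / (25 * a ^+ 2) by rewrite !divr_ge0//; lra.
    have h5 : 0 <= c0 * a ^+ 2 / 6 by rewrite divr_ge0// mulr_ge0//; lra.
    apply: le_trans (ler_pM h4 h5 h3 (ltW v2)).
    have -> : c1 / 6 / (25 * a ^+ 2) * (c0 * a ^+ 2 / 6) = c1 * c0 / 900.
      by field; rewrite gt_eqF.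
    have := ler_wpM2l (ltW c10) c01; lra.
  move: h2; rewrite ler_pXn2r ?nnegrE ?mulr_ge0 ?(ltW rho0)//; [lra|lra].
have h1 := bad_al0 r t t0 t1.
have h2 : err al0 r t <= err al r t + t%:~R ^+ 2 * `|al - al0|.
  rewrite !errE// -mulrDr ler_pM2l ?exprn_gt0//.
  have := ler_normB (al - r%:~R / t%:~R) (al - al0).
  by have -> : al - r%:~R / t%:~R - (al - al0) = al0 - r%:~R / t%:~R by ring.
have h3 : t%:~R ^+ 2 * `|al - al0| <= c1 / 6 * q0 ^+ 2 * (3 / q0 ^+ 2).
  by apply: ler_pM; rewrite ?sqr_ge0// ltW.
have h4 : c1 / 6 * q0 ^+ 2 * (3 / q0 ^+ 2) = c1 / 2.
  by field; rewrite gt_eqF.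
lra.
Qed.

End LinearForms.

Section Insertion.
Variable R : realType.

Lemma const_bounds (B : nat) : (1 < B)%N ->
  [/\ 7 <= Nb R B, 0 < bad1 R B, bad1 R B <= bad0 R B, bad0 R B <= 1 &
     0 < kap R B /\ kap R B <= (2 * Nb R B)^-1].
Proof.
move=> B1.
have N7 : 7 <= Nb R B by rewrite /Nb ler_nat; lia.
have i0 : 0 < (2 * Nb R B)^-1 by rewrite invr_gt0; lra.
have i1 : (2 * Nb R B)^-1 <= 1 by rewrite invf_le1; lra.
have b0 : 0 < bad0 R B by rewrite /bad0 mulr_gt0.
have b1 : bad0 R B <= (2 * Nb R B)^-1 by rewrite /bad0 ger_pMr.
have k0 : 0 < kap R B by apply: divr_gt0; [exact: b0|rewrite ltr0n].
have k1 : kap R B <= bad0 R B by rewrite /kap; lra.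
have c1 : bad1 R B <= kap R B by rewrite /bad1 ger_pMr.
have c0 : 0 < bad1 R B by rewrite /bad1 mulr_gt0.
split; [done|done|exact: le_trans k1|exact: le_trans i1|].
by split => //; exact: le_trans b1.
Qed.

Lemma badly_pos (c0 x : R) :
  (forall p q : int, 0 < q -> c0 <= err x p q) -> badly c0 x.
Proof.
move=> H u v v0; have [vpos|vneg|v0'] := ltgtP v 0; last by rewrite v0' in v0.
  have := H (- u) (- v); rewrite oppr_gt0 => /(_ vpos); rewrite /err.
  have vR : v%:~R < 0 :> R by rewrite ltrz0.
  rewrite (ltr0_norm vR) !intrN.
  by rewrite (_ : - v%:~R * x - - u%:~R = - (v%:~R * x - u%:~R)) ?normrN//; ring.
have vR : 0 < v%:~R :> R by rewrite ltr0z.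
by have := H u v vneg; rewrite /err (gtr0_norm vR).
Qed.

(** Every t is the sum of two badly approximable numbers, with a constant
    independent of t. *)
Lemma bad_pair (B : nat) (t : R) : (1 < B)%N ->
  exists y : R, badly (bad0 R B) y /\ badly (bad0 R B) (t - y).
Proof.
move=> B1; have [N7 _ _ _ _] := const_bounds B1.
have k0 : 0 < (2 * Nb R B)^-1 by rewrite invr_gt0; lra.
have [y _ yP] := bad_point t 0 B1 k0 k0 (lexx _).
have Hq (q : int) : 0 < q -> (2 * Nb R B)^-1 <= q%:~R ^+ 2 * (2 * Nb R B)^-1.
  move=> q0; rewrite ler_peMl ?(ltW k0)// exprn_ege1// ler1z -gtz0_ge1//.
by exists y; split; apply: badly_pos => p q q0; have [] := yP p q q0 (Hq q q0).
Qed.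

Lemma dirichlet_err (x : R) (p q : int) (Q : nat) :
  0 < q -> q <= Q -> `|q%:~R * x - p%:~R| < Q%:R^-1 ->
  err x p q < q%:~R / Q%:R /\ err x p q <= 1.
Proof.
move=> q0 qQ H; have q0' : 0 < q%:~R :> R by rewrite ltr0z.
have h : err x p q < q%:~R / Q%:R by rewrite /err ltr_pM2l.
split => //; apply: (le_trans (ltW h)).
have qQ' : q%:~R <= Q%:R :> R by rewrite pmulrn ler_int.
by rewrite ler_pdivrMr ?mul1r//; exact: lt_le_trans qQ'.
Qed.

(** The denominator q0 of the basis chosen in an interval of length l satisfies
    q0^2 l <= 4 depth.  The first term makes q0 large enough for the new
    interval to lie well inside the old one.  The second one makes sure that
    q0^2 l >= kap: below that scale, the weak bound err >= c / 2 already
    excludes so good an approximation. *)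
Definition depth (B : nat) (c : R) : R :=
  3 * Nb R B / bad1 R B ^+ 2 + 4 / c ^+ 2.

Lemma depth_bounds (B : nat) (c : R) : (1 < B)%N -> 0 < c ->
  [/\ 3 * Nb R B <= bad1 R B ^+ 2 * depth B c, 4 <= c ^+ 2 * depth B c &
      1 <= depth B c].
Proof.
move=> B1 c0; have [N7 c1pos c10 c01 [k0 kN]] := const_bounds B1.
rewrite /depth; set N := Nb R B in N7 *; set C1 := bad1 R B in c1pos c10 *.
have C12 : 0 < C1 ^+ 2 by rewrite exprn_gt0.
have c2 : 0 < c ^+ 2 by rewrite exprn_gt0.
have K3 : 3 * N <= C1 ^+ 2 * (3 * N / C1 ^+ 2 + 4 / c ^+ 2).
  rewrite mulrDr (mulrC (C1 ^+ 2)) divfK ?gt_eqF// lerDl.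
  by rewrite mulr_ge0 ?divr_ge0 ?ltW.
have K4 : 4 <= c ^+ 2 * (3 * N / C1 ^+ 2 + 4 / c ^+ 2).
  rewrite mulrDr (mulrC (c ^+ 2) (4 / _)) divfK ?gt_eqF// lerDr.
  by rewrite mulr_ge0 ?divr_ge0 ?(ltW c2) ?(ltW C12)//; lra.
split => //; move: K3; set K := _ + _ => K3.
have C11 : C1 ^+ 2 <= 1 by rewrite exprn_ile1 ?(ltW c1pos)//; exact: le_trans c01.
have K0 : 0 < K by rewrite -(pmulr_rgt0 _ C12); apply: lt_le_trans K3; lra.
apply: (@le_trans _ _ (C1 ^+ 2 * K)); first by apply: le_trans K3; lra.
by rewrite ger_pMl.
Qed.

(** An interval is coded by its left end and its length. *)
Definition inI (I : R * R) (x : R) := I.1 <= x <= I.1 + I.2.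

(** Invariant of the construction: all the rationals resolved by [I], that is,
    with q^2 I.2 < kap B, satisfy err >= c / 2 at all points of [I]. *)
Definition valid (B : nat) (c : R) (I : R * R) := [/\ 0 < I.2, I.2 <= 1 &
  forall x, inI I x -> forall p q : int, 0 < q ->
    q%:~R ^+ 2 * I.2 < kap R B -> c / 2 <= err x p q].

(** Inside any valid interval [I], for any [lo] between c - 2 eta and c, there
    is a subinterval [J] of length at least sig I.2 on which the rationals
    resolved by [J] and not by [I] have err >= lo, while some rational not
    resolved by [I] has err <= lo + eta. *)
Definition insertable (B : nat) (c eta sig : R) :=
  forall (I : R * R) (lo : R), valid B c I -> c - 2 * eta <= lo -> lo <= c ->
  exists J : R * R, [/\ I.1 <= J.1, J.1 + J.2 <= I.1 + I.2, 0 < J.2,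
    sig * I.2 <= J.2 & forall x, inI J x ->
    (forall p q : int, 0 < q -> kap R B <= q%:~R ^+ 2 * I.2 ->
       q%:~R ^+ 2 * J.2 < kap R B -> lo <= err x p q) /\
    (exists p q : int, [/\ 0 < q, kap R B <= q%:~R ^+ 2 * I.2 &
       err x p q <= lo + eta])].

(** A basis whose first vector approximates a badly approximable point of the
    interval, with a denominator comparable to l^(-1/2). *)
Lemma good_basis (B : nat) (c x0 l : R) : (1 < B)%N -> 0 < c ->
  valid B c (x0, l) ->
  exists (al0 : R) (p0 q0 p0' q0' : int),
   [/\ [/\ 0 < q0, q0 <= q0', q0' <= 2 * q0 & p0 * q0' - p0' * q0 = 1],
    x0 + l / Nb R B <= al0 <= x0 + l - l / Nb R B,
    forall p q : int, 0 < q -> kap R B <= q%:~R ^+ 2 * l -> bad1 R B <= err al0 p q,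
    `|al0 - p0%:~R / q0%:~R| <= 1 / q0%:~R ^+ 2 &
    [/\ kap R B <= q0%:~R ^+ 2 * l, 3 * Nb R B <= q0%:~R ^+ 2 * l &
        q0%:~R ^+ 2 * l <= 4 * depth B c]].
Proof.
move=> B1 c0 [/= l0 l1 ctrl].
have [N7 c1pos c10 c01 [k0 kN]] := const_bounds B1.
have [K3 K4 K1'] := depth_bounds B1 c0.
have [al0 /andP[al1 al2] bad_al0] := bad_point 0 x0 B1 l0 k0 kN.
rewrite -/(Nb R B) in al1 al2.
have K11 : kap R B <= 1 by apply: (le_trans kN); rewrite invf_le1; lra.
move: (depth B c) K3 K4 K1' => K K3 K4 K1'.
set N := Nb R B in N7 kN al1 al2 K3 *; set C1 := bad1 R B in c1pos c10 K3 *.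
set K1 := kap R B in k0 kN K11 *.
have w0 : 0 < l / N by apply: divr_gt0 => //; apply: lt_le_trans N7.
(* Dirichlet's bound Q is the integer following X *)
pose X := Num.sqrt (K / l).
have Kl : 1 <= K / l by rewrite ler_pdivlMr// mul1r; exact: le_trans K1'.
have XX : X ^+ 2 = K / l by rewrite sqr_sqrtr//; exact: le_trans Kl.
have X1 : 1 <= X.
  by rewrite -(@ler_pXn2r _ 2) ?nnegrE ?sqrtr_ge0// expr1n XX.
pose Q := (Num.trunc X).+1.
have /andP[Q1 Q2] := truncn_itv (le_trans ler01 X1).
have Q2' : K / l <= Q%:R ^+ 2.
  by rewrite -XX ler_pXn2r ?nnegrE ?sqrtr_ge0// ltW.
have Q3 : Q%:R ^+ 2 <= 4 * (K / l).
  have -> : 4 * (K / l) = (2 * X) ^+ 2 by rewrite -XX; ring.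
  rewrite ler_pXn2r ?nnegrE ?mulr_ge0 ?sqrtr_ge0//.
  by rewrite /Q -natr1 mulr2n mulrDl mul1r lerD.
have Q0 : (0 < Q)%N by [].
have Q0' : 0 < Q%:R :> R by rewrite ltr0n.
have [p0 [q0 [p0' [q0' [q00 q0Q pq0 det0 /andP[qq0' q0'2]]]]]] := dirichlet_basis al0 Q0.
have [f1 f2] := dirichlet_err q00 q0Q pq0.
have q00' : 0 < q0%:~R :> R by rewrite ltr0z.
have q0Q' : q0%:~R <= Q%:R :> R by rewrite pmulrn ler_int.
have al0I : x0 <= al0 <= x0 + l.
  apply/andP; split; first by apply: le_trans al1; rewrite lerDl ltW.
  by apply: (le_trans al2); rewrite gerBl ltW.
have sq (d : R) : 0 < d -> d * Q%:R <= q0%:~R -> d ^+ 2 * K <= q0%:~R ^+ 2 * l.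
  move=> d0 dQ; apply: (@le_trans _ _ (d ^+ 2 * Q%:R ^+ 2 * l)).
    by rewrite -mulrA ler_pM2l ?exprn_gt0// -ler_pdivrMr.
  rewrite ler_pM2r// -exprMn ler_pXn2r ?nnegrE ?mulr_ge0 ?(ltW d0) ?(ltW q00')//.
have kq0 : K1 <= q0%:~R ^+ 2 * l.
  rewrite leNgt; apply/negP => small.
  have := ctrl al0 al0I p0 q0 q00 small => h.
  have : c / 2 * Q%:R <= q0%:~R by rewrite -ler_pdivlMr//; apply: (le_trans h); exact: ltW.
  have c20 : 0 < c / 2 by rewrite divr_gt0.
  move=> /(sq _ c20); have -> : (c / 2) ^+ 2 * K = c ^+ 2 * K / 4 by field.
  by apply/negP; rewrite -ltNge (lt_le_trans small)// (le_trans K11)// ler_pdivlMr// mul1r.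
have q0big : 3 * N <= q0%:~R ^+ 2 * l.
  have [h _] := bad_al0 p0 q0 q00 kq0.
  apply: (le_trans K3); apply: sq => //.
  by rewrite -ler_pdivlMr//; apply: (le_trans h); exact: ltW.
exists al0, p0, q0, p0', q0'; split => //.
- by split => //; exact: ltW.
- by rewrite al1.
- by move=> p q q1 q2; have [] := bad_al0 p q q1 q2.
- by rewrite ler_pdivlMr ?exprn_gt0// mulrC -errE.
split => //; rewrite -ler_pdivlMr// -mulrA; apply: le_trans Q3.
by rewrite ler_pXn2r ?nnegrE ?(ltW q00') ?(ltW Q0').
Qed.

(** The matrix with rows (p, p') and (q, q') is the product of the one with rows
    (p0, p0') and (q0, q0') by the one with rows (a, b) and (a', b').  Thus p/q
    remains close to p0/q0, and q'/q, which combines b/a and b'/a', is close to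
    y. *)
Lemma product_basis (y : R) (a b a' b' p0 q0 p0' q0' : int) :
  0 < a -> a <= a' -> a' <= 2 * a -> b * a' - b' * a = 1 ->
  `|y - b%:~R / a%:~R| <= 1 / a%:~R ^+ 2 ->
  0 < q0 -> q0 <= q0' -> q0' <= 2 * q0 -> p0 * q0' - p0' * q0 = 1 ->
  exists p q p' q' : int, [/\ p * q' - p' * q = - 1, q0 <= q,
    q%:~R <= 5 * (q0%:~R * a%:~R) :> R,
    `|q'%:~R / q%:~R - y| <= 2 / a%:~R ^+ 2 &
    `|p%:~R / q%:~R - p0%:~R / q0%:~R| <= 1 / q0%:~R ^+ 2 :> R].
Proof.
move=> a0 aa' a'2 det ya q00 qq0' q0'2 det0.
have a'0 : 0 < a' by exact: lt_le_trans aa'.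
have q0'0 : 0 < q0' by exact: lt_le_trans qq0'.
exists (p0 * a + p0' * a'), (q0 * a + q0' * a'), (p0 * b + p0' * b'), (q0 * b + q0' * b').
split.
- transitivity (- ((p0 * q0' - p0' * q0) * (b * a' - b' * a))); first by ring.
  by rewrite det0 det mulr1.
- apply: (@le_trans _ _ (q0 * a)).
    by rewrite ler_peMr ?(ltW q00)// -gtz0_ge1.
  by rewrite lerDl mulr_ge0// ltW.
- have i1 : q0'%:~R <= 2 * q0%:~R :> R by rewrite -[2]/(2%:~R) -intrM ler_int.
  have i2 : a'%:~R <= 2 * a%:~R :> R by rewrite -[2]/(2%:~R) -intrM ler_int.
  have h5 : q0'%:~R * a'%:~R <= (2 * q0%:~R) * (2 * a%:~R) :> R.
    by apply: ler_pM => //; rewrite ler0z ltW.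
  rewrite intrD !intrM; lra.
- have cq : `|(q0 * b + q0' * b')%:~R / (q0 * a + q0' * a')%:~R - b%:~R / a%:~R| <=
      1 / a%:~R ^+ 2 :> R by apply: comb_close => //; exact: ltW.
  move: cq; move: (_ / (_ + _)%:~R) => z cq.
  have := ler_normB (z - b%:~R / a%:~R) (y - b%:~R / a%:~R).
  have -> : z - b%:~R / a%:~R - (y - b%:~R / a%:~R) = z - y by ring.
  lra.
- rewrite (mulrC p0) (mulrC p0') (mulrC q0) (mulrC q0').
  by apply: comb_close => //; exact: ltW.
Qed.

(** The interval to the right of p/q on which lo <= err x p q <= lo + eta. *)
Lemma special_param (p q lo eta x : R) : 0 < q ->
  p / q + lo / q ^+ 2 <= x <= p / q + lo / q ^+ 2 + eta / q ^+ 2 ->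
  lo <= q * (q * x - p) <= lo + eta.
Proof.
move=> q0; have q2 : 0 < q ^+ 2 by rewrite exprn_gt0.
have -> : q * (q * x - p) = q ^+ 2 * (x - p / q) by field; rewrite gt_eqF.
rewrite -addrA -mulrDl -lerBrDl => /andP[h1 h2]; rewrite mulrC.
by rewrite -ler_pdivrMr// h1 -ler_pdivlMr// lerBlDl.
Qed.

Lemma margin (lo hi w al z e : R) : lo + w <= al -> al <= hi - w ->
  e <= w -> `|z - al| <= e -> lo <= z /\ z <= hi.
Proof. by move=> h1 h2 h3; rewrite ler_norml => /andP[h4 h5]; split; lra. Qed.

Lemma size_bound (c a K q q0 l : R) : 0 < a -> 0 < K -> 0 < q ->
  0 < l -> q <= 5 * (q0 * a) -> q0 ^+ 2 * l <= 4 * K ->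
  c ^+ 2 / (400 * a ^+ 4 * K) * l <= c ^+ 2 / (4 * a ^+ 2) / q ^+ 2.
Proof.
move=> a0 K0 q0' l0 qq q0K.
have qq2 : q ^+ 2 <= (5 * (q0 * a)) ^+ 2.
  by rewrite ler_pXn2r ?nnegrE ?(ltW q0')//; apply: le_trans qq; exact: ltW.
have h : q ^+ 2 * l <= 100 * a ^+ 2 * K.
  apply: (@le_trans _ _ ((5 * (q0 * a)) ^+ 2 * l)); first by rewrite ler_wpM2r// ltW.
  have -> : (5 * (q0 * a)) ^+ 2 * l = 25 * a ^+ 2 * (q0 ^+ 2 * l) by ring.
  have -> : 100 * a ^+ 2 * K = 25 * a ^+ 2 * (4 * K) by ring.
  by apply: ler_wpM2l => //; apply: mulr_ge0; [rewrite ler0n|exact: sqr_ge0].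
rewrite ler_pdivlMr ?exprn_gt0//.
have -> : c ^+ 2 / (400 * a ^+ 4 * K) * l * q ^+ 2 =
    c ^+ 2 / (400 * a ^+ 4 * K) * (q ^+ 2 * l) by ring.
have -> : c ^+ 2 / (4 * a ^+ 2) =
    c ^+ 2 / (400 * a ^+ 4 * K) * (100 * a ^+ 2 * K).
  by field; rewrite !gt_eqF.
apply: ler_wpM2l h; apply: divr_ge0; first exact: sqr_ge0.
apply: mulr_ge0; last exact: ltW.
by apply: mulr_ge0; [rewrite ler0n|rewrite exprn_ge0// ltW].
Qed.

(** The parameter A makes eta as small as desired; neither eta nor sig depends
    on the interval. *)
Lemma insertion (B : nat) (c y : R) (A : nat) : (1 < B)%N -> 0 < c ->
  c <= bad1 R B / 60 -> badly (bad0 R B) y -> badly (bad0 R B) (c^-1 - y) ->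
  (0 < A)%N ->
  exists es : R * R, [/\ 0 < es.1, es.1 <= c / 4, es.1 <= A%:R^-1, 0 < es.2 &
    insertable B c es.1 es.2].
Proof.
move=> B1 c0 cle bady badx A0.
have [N7 c1pos c10 c01 [k0 kN]] := const_bounds B1.
have C0pos : 0 < bad0 R B by exact: lt_le_trans c10.
have c1' : c <= 1 / 2 by lra.
have cC : c <= bad0 R B by lra.
have [b [a [b' [a' [a0 aA ayb det /andP[aa' a'2]]]]]] := dirichlet_basis y A0.
have A0' : 0 < A%:R :> R by rewrite ltr0n.
have [e1 e2] := dirichlet_err a0 aA ayb.
have a1 : 1 <= a%:~R :> R by rewrite ler1z -gtz0_ge1.
have apos : 0 < a%:~R :> R by exact: lt_le_trans a1.
have ageA : bad0 R B * A%:R <= a%:~R.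
  rewrite -ler_pdivlMr//; have := bady b a (negbT (gt_eqF a0)).
  by rewrite gtr0_norm// => h; rewrite (le_trans h)// ltW.
have ya : `|y - b%:~R / a%:~R| <= 1 / a%:~R ^+ 2.
  by rewrite ler_pdivlMr ?exprn_gt0// mulrC -errE.
pose eta := c ^+ 2 / (4 * a%:~R ^+ 2).
have a2 : 1 <= a%:~R ^+ 2 :> R by rewrite exprn_ege1.
have c2 : 0 < c ^+ 2 by rewrite exprn_gt0.
have eta0 : 0 < eta by rewrite divr_gt0// mulr_gt0 ?exprn_gt0.
have etac : eta <= c / 4.
  rewrite /eta ler_pdivrMr ?mulr_gt0 ?exprn_gt0//.
  have -> : c / 4 * (4 * a%:~R ^+ 2) = c * a%:~R ^+ 2 by field.
  rewrite expr2 ler_pM2l//; apply: le_trans a2; lra.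
have etaA : eta <= A%:R^-1.
  rewrite /eta ler_pdivrMr ?mulr_gt0 ?exprn_gt0//.
  rewrite -(ler_pM2l A0') [leRHS]mulrA mulfV ?gt_eqF// mul1r.
  have A1 : 1 <= A%:R :> R by rewrite ler1n.
  apply: (@le_trans _ _ (A%:R ^+ 2 * c ^+ 2)).
    by rewrite ler_wpM2r ?sqr_ge0// expr2 ler_peMl// ltW.
  apply: (@le_trans _ _ (a%:~R ^+ 2)); last by lra.
  rewrite -exprMn ler_pXn2r ?nnegrE ?mulr_ge0 ?(ltW c0)// ?(ltW apos)//.
  by rewrite mulrC; apply: le_trans ageA; rewrite ler_wpM2r// ltW.
have [_ _ K1] := depth_bounds B1 c0.
have K0 : 0 < depth B c by exact: lt_le_trans K1.
pose sigma := c ^+ 2 / (400 * a%:~R ^+ 4 * depth B c).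
have sigma0 : 0 < sigma.
  apply: divr_gt0; first exact: c2.
  apply: mulr_gt0; last exact: K0.
  by apply: mulr_gt0; [rewrite ltr0n|rewrite exprn_gt0].
exists (eta, sigma); split => // -[x0 l] lo vI;
  rewrite [(eta, _).1]/= => lo1 lo2.
have [/= l0 _ _] := vI.
have [al0 [p0 [q0 [p0' [q0' [[q00 qq0' q0'2 det0] /andP[al1 al2] bad_al0 q0al
  [kq0 q0big q0K]]]]]]] := good_basis B1 c0 vI.
have [p [q [p' [q' [detP qge qlt yq cp]]]]] :=
  product_basis a0 aa' (ltW a'2) det ya q00 qq0' q0'2 det0.
have q00' : 0 < q0%:~R :> R by rewrite ltr0z.
have qgt0 : 0 < q by exact: lt_le_trans qge.
have qpos : 0 < q%:~R :> R by rewrite ltr0z.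
have qgeR : q0%:~R <= q%:~R :> R by rewrite ler_int.
have q2 : 0 < q%:~R ^+ 2 :> R by rewrite exprn_gt0.
have lo0 : c / 2 <= lo by clear -lo1 etac; move: eta etac lo1 => e *; lra.
have loc : lo + eta <= 2 * c by clear -lo2 etac c0; move: eta etac => e *; lra.
have clos x : p%:~R / q%:~R + lo / q%:~R ^+ 2 <= x <=
    p%:~R / q%:~R + lo / q%:~R ^+ 2 + eta / q%:~R ^+ 2 ->
    `|x - al0| <= 3 / q0%:~R ^+ 2.
  move=> /(special_param qpos) /andP[h1 h2].
  apply: (special_close q00' qgeR cp q0al erefl); apply/andP; split.
    by apply: le_trans h1; apply: le_trans lo0; rewrite divr_ge0 ?ltW.
  by apply: (le_trans h2); apply: (le_trans loc); clear -c1'; lra.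
have q0N : 3 / q0%:~R ^+ 2 <= l / Nb R B.
  rewrite ler_pdivrMr ?exprn_gt0// mulrAC ler_pdivlMr; last exact: lt_le_trans N7.
  by rewrite (mulrC l).
have etaq : 0 < eta / q%:~R ^+ 2 by rewrite divr_gt0.
exists (p%:~R / q%:~R + lo / q%:~R ^+ 2, eta / q%:~R ^+ 2); split => //=.
- have [] := margin al1 al2 q0N (clos (p%:~R / q%:~R + lo / q%:~R ^+ 2) _) => //.
  by rewrite lexx lerDl ltW.
- have [] := margin al1 al2 q0N
    (clos (p%:~R / q%:~R + lo / q%:~R ^+ 2 + eta / q%:~R ^+ 2) _) => //.
  by rewrite lexx lerDl ltW.
- exact: size_bound qlt q0K.
move=> x xJ; have /andP[x1 x2] := special_param qpos xJ.
split; last first.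
  exists p, q; split => //.
    apply: (le_trans kq0); rewrite ler_pM2r// ler_pXn2r ?nnegrE ?(ltW q00') ?(ltW qpos)//.
  rewrite /err ger0_norm// -(pmulr_rge0 _ qpos).
  by apply: le_trans x1; apply: le_trans lo0; rewrite divr_ge0 ?ltW.
move=> r t t0 t1 t2.
have [[-> ->]|h] : (r = p /\ t = q) \/ c <= err x r t; last by exact: le_trans h.
  have kE : kap R B = bad0 R B / 384 by [].
  have sr : c / 2 <= q%:~R * (q%:~R * x - p%:~R) <= 2 * c.
    by rewrite (le_trans lo0 x1) (le_trans x2 loc).
  have ds : `|c - q%:~R * (q%:~R * x - p%:~R)| <= 2 * eta.
    move: x1 x2 lo1 lo2 eta0; clear; move: (_ * (_ - _)) eta => s e.
    by move=> *; rewrite ler_norml; apply/andP; split; lra.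
  have SL := special_lower c1pos c10 kE c0 cle bady badx a1 q00' bad_al0 qgt0
    detP qlt yq (erefl eta) erefl.
  exact: (SL _ sr ds (clos _ xJ)).
rewrite /err; apply: (le_trans x1); rewrite ler_pM2l//; exact: ler_norm.
Qed.

End Insertion.

(** * The tree of intervals *)

Section Tree.
Variable R : realType.

(** Guaranteed ratio of lengths from one level to the next, where [o] tells
    which insertion, if any, follows the division into N parts. *)
Definition factor (N : R) (sig : nat -> R) (o : option nat) : R :=
  if o is Some k then sig k / N else N^-1.

(** Insertion number k is made at the first level n, after insertion k - 1, such
    that the guaranteed length is still at least l0 beta^(n+1) afterwards.
    Such a level exists because lam n / beta^n grows geometrically in the
    meantime. *)
Lemma schedule (N beta l0 : R) (sig : nat -> R) :
  0 < N -> 0 < beta -> N * beta < 1 -> 0 < l0 -> (forall k, 0 < sig k) ->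
  exists (sched : nat -> option nat) (lam : nat -> R),
  [/\ lam 0%N = l0, forall n, l0 * beta ^+ n <= lam n,
    forall n, lam n.+1 = factor N sig (sched n) * lam n,
    forall n0, exists2 n, (n0 <= n)%N & exists k, sched n = Some k &
    forall k0, exists n0, forall n k, (n0 <= n)%N -> sched n = Some k -> (k0 <= k)%N].
Proof.
move=> N0 b0 Nb1 l00 sig0.
(* the state (k, lam) holds the number of the next insertion *)
pose dec (n : nat) (s : nat * R) : option nat :=
  if l0 * beta ^+ n.+1 <= sig s.1 / N * s.2 then Some s.1 else None.
pose nxt n (s : nat * R) : nat * R :=
  ((s.1 + isSome (dec n s))%N, factor N sig (dec n s) * s.2).
pose st := fix st n := if n is n'.+1 then nxt n' (st n') else (0%N, l0).
pose sched n := dec n (st n); pose lam n := (st n).2; pose cnt n := (st n).1.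
have schedE n k : sched n = Some k -> k = cnt n /\ cnt n.+1 = (cnt n).+1.
  rewrite /sched /cnt /= /nxt /dec; case: ifP => //= _ [<-]; by rewrite addn1.
have cntS n : (cnt n <= cnt n.+1)%N by rewrite /cnt /= leq_addr.
have cntM n0 n : (n0 <= n)%N -> (cnt n0 <= cnt n)%N.
  elim: n => [|n IH]; first by rewrite leqn0 => /eqP ->.
  rewrite leq_eqVlt => /predU1P[->//|/IH h]; exact: leq_trans (cntS n).
have lamS n : lam n.+1 = factor N sig (sched n) * lam n by [].
have lamb n : l0 * beta ^+ n <= lam n.
  elim: n => [|n IH]; first by rewrite expr0 mulr1.
  rewrite lamS /sched /dec -/(lam n); case: ifP => //= _.
  rewrite exprS mulrCA (mulrC N^-1) ler_pdivlMr//.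
  apply: le_trans IH; rewrite mulrAC (mulrC beta) ler_piMl// ?(ltW Nb1)//.
  by rewrite mulr_ge0 ?exprn_ge0 ?ltW.
have inf n0 : exists2 n, (n0 <= n)%N & exists k, sched n = Some k.
  apply: contrapT => H.
  have none n : (n0 <= n)%N -> sched n = None.
    move=> hn; case E: (sched n) => [k|//]; case: H; exists n => //; by exists k.
  have cc i : cnt (i + n0)%N = cnt n0.
    elim: i => // i IH; rewrite addSn -IH.
    have := none (i + n0)%N (leq_addl _ _).
    by rewrite /sched /cnt /= /nxt => -> /=; rewrite addn0.
  have ll i : lam (i + n0)%N * N ^+ i = lam n0.
    elim: i => [|i IH]; first by rewrite expr0 mulr1.
    rewrite addSn lamS (none _ (leq_addl _ _)) /= -IH exprS.
    by field; rewrite gt_eqF.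
  have lpos : 0 < lam n0 by apply: lt_le_trans (lamb n0); rewrite mulr_gt0 ?exprn_gt0.
  pose K := sig (cnt n0) * lam n0 / N / (l0 * beta ^+ n0 * beta).
  have K0 : 0 < K by rewrite !divr_gt0 ?mulr_gt0 ?exprn_gt0.
  have [i Hi] : exists i, (N * beta) ^+ i < K.
    have := cvg_expr (_ : `|N * beta| < 1).
    rewrite ger0_norm ?mulr_ge0 ?ltW// => /(_ Nb1) /cvgrPdist_lt /(_ _ K0) [i _ /(_ i)] /=.
    rewrite leqnn sub0r normrN => /(_ isT); rewrite ger0_norm; first by exists i.
    by rewrite exprn_ge0// mulr_ge0 ?ltW.
  have := none (i + n0)%N (leq_addl _ _).
  rewrite /sched /dec -/(lam _) -/(cnt _) cc; case: ifP => // /negbT.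
  rewrite -ltNge => h _.
  move: Hi; rewrite ltNge => /negP; apply.
  rewrite /K ler_pdivrMr ?mulr_gt0 ?exprn_gt0//.
  have Ni : 0 < N ^+ i by rewrite exprn_gt0.
  move: h => /ltW; rewrite -(ler_pM2r Ni).
  have -> : sig (cnt n0) / N * lam (i + n0)%N * N ^+ i =
      sig (cnt n0) * (lam (i + n0)%N * N ^+ i) / N by ring.
  rewrite ll => h; apply: (le_trans h).
  by rewrite exprMn exprS exprD le_eqVlt; apply/orP; left; apply/eqP; ring.
exists sched, lam; split => // k0.
have [n0 hn0] : exists n0, (k0 <= cnt n0)%N.
  elim: k0 => [|k [n0 IH]]; first by exists 0%N.
  have [n n0n [j /schedE [_ E]]] := inf n0.
  by exists n.+1; rewrite E ltnS; apply: leq_trans IH _; exact: cntM.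
exists n0 => n k n0n /schedE [-> _]; exact: leq_trans hn0 (cntM _ _ n0n).
Qed.

(** Base B digits: if n is the first index where the digits of u and v differ
    then |u - v| <= B^-n. *)
Lemma digits (B : nat) : (1 < B)%N ->
  exists dg : R -> nat -> nat, (forall u n, 0 <= u < 1 -> (dg u n < B)%N) /\
  forall u v, 0 <= u < 1 -> 0 <= v < 1 -> u != v ->
   exists n, [/\ forall j, (j < n)%N -> dg u j = dg v j, dg u n <> dg v n &
     `|u - v| * B%:R ^+ n <= 1].
Proof.
move=> B1; have B0 : (0 < B)%N by exact: ltnW.
have B0' : 0 < B%:R :> R by rewrite ltr0n.
pose fl (u : R) n := Num.trunc (B%:R ^+ n * u).
have itv u n : 0 <= u -> (fl u n)%:R <= B%:R ^+ n * u < (fl u n).+1%:R.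
  by move=> u0; apply: truncn_itv; rewrite mulr_ge0// exprn_ge0// ltW.
have lo u n : 0 <= u -> (B * fl u n <= fl u n.+1)%N.
  move=> u0; have /andP[h1 _] := itv u n u0; have /andP[_ h2] := itv u n.+1 u0.
  rewrite -ltnS -(ltr_nat R); apply: le_lt_trans h2.
  by rewrite natrM exprS -mulrA ler_pM2l.
have hi u n : 0 <= u -> (fl u n.+1 < B * (fl u n).+1)%N.
  move=> u0; have /andP[_ h1] := itv u n u0; have /andP[h2 _] := itv u n.+1 u0.
  rewrite -(ltr_nat R); apply: (le_lt_trans h2).
  by rewrite natrM exprS -mulrA ltr_pM2l.
exists (fun u n => fl u n.+1 - B * fl u n)%N; split.
  by move=> u n /andP[u0 _]; rewrite ltn_subLR ?lo// -mulnSr hi.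
move=> u v /andP[u0 u1] /andP[v0 v1] uv.
have near n : fl u n = fl v n -> `|u - v| * B%:R ^+ n <= 1.
  move=> e; have /andP[a1 a2] := itv u n u0; have /andP[b1 b2] := itv v n v0.
  have Bn : 0 < B%:R ^+ n :> R by rewrite exprn_gt0.
  rewrite -{1}(gtr0_norm Bn) -normrM mulrC mulrBr ler_norml.
  rewrite e -natr1 in a1 a2; rewrite -natr1 in b2.
  by apply/andP; split; lra.
have uv0 : 0 < `|u - v| by rewrite normr_gt0 subr_eq0.
have ex : exists n, fl u n != fl v n.
  apply: contrapT => /forallNP H.
  pose n := (Num.trunc `|u - v|^-1).+1.
  have /near : fl u n = fl v n by apply/eqP; apply: contrapT => /negP; exact: H.
  have iv0 : 0 <= `|u - v|^-1 by rewrite invr_ge0.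
  have /andP[_ h] := truncn_itv iv0.
  rewrite -ler_pdivlMl// mulr1 leNgt => /negP; apply; apply: (lt_le_trans h).
  rewrite -natrX ler_nat /n ltnW//; apply: leq_trans (ltn_expl _ B1) _.
  by rewrite leqnn.
case: (ex_minnP ex) => -[|n] hn min.
  have z w : 0 <= w < 1 -> fl w 0%N = 0%N.
    by move=> w01; rewrite /fl expr0 mul1r; apply: truncn_def.
  by move: hn; rewrite !z ?u0 ?v0.
have agree j : (j <= n)%N -> fl u j = fl v j.
  by move=> jn; apply/eqP; apply: contraTT jn => /min; rewrite -ltnNge.
exists n; split; [|move=> e|exact/near/agree].
  by move=> j jn; rewrite !agree// ltnW.
have := lo u n u0; have := lo v n v0; rewrite (agree n (leqnn n)) in e *.
by move=> h1 h2; case/eqP: hn; rewrite -(subnK h1) -(subnK h2) e.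
Qed.

(** Lower bound for err at a level whose insertion is given by [o]. *)
Definition lower (c : R) (lo : nat -> R) (o : option nat) : R :=
  if o is Some k then lo k else c.

(** What is needed of the successor [J] of [I] at a level with insertion [o]. *)
Definition good_child (B : nat) (c : R) (eta sig lo : nat -> R) (o : option nat)
    (I J : R * R) :=
  [/\ valid B c J, I.1 <= J.1 /\ J.1 + J.2 <= I.1 + I.2, J.2 <= I.2 / 2,
    factor (Nb R B) sig o * I.2 <= J.2 &
    forall x, inI J x ->
      (forall p q : int, 0 < q -> kap R B <= q%:~R ^+ 2 * I.2 ->
         q%:~R ^+ 2 * J.2 < kap R B -> lower c lo o <= err x p q) /\
      (forall k, o = Some k -> exists p q : int,
         [/\ 0 < q, kap R B <= q%:~R ^+ 2 * I.2 & err x p q <= lo k + eta k])].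

(** Distinct odd-numbered parts are separated by a whole part. *)
Lemma slots_apart (w a x x' : R) (j j' : nat) : 0 < w -> j != j' ->
  a + (2 * j%:R + 1) * w <= x -> x <= a + (2 * j%:R + 2) * w ->
  a + (2 * j'%:R + 1) * w <= x' -> x' <= a + (2 * j'%:R + 2) * w ->
  w <= `|x - x'|.
Proof.
move=> w0 jj x1 x2 y1 y2.
have {jj}[jj|jj] : (j + 1 <= j')%N \/ (j' + 1 <= j)%N by move/eqP: jj; lia.
  have : (j%:R + 1 <= j'%:R :> R) by rewrite natr1 -addn1 ler_nat.
  move=> /(ler_wpM2r (ltW w0)) H.
  rewrite distrC ger0_norm; lra.
have : (j'%:R + 1 <= j%:R :> R) by rewrite natr1 -addn1 ler_nat.
move=> /(ler_wpM2r (ltW w0)) H.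
by rewrite ger0_norm; lra.
Qed.

Lemma sub_length (a b l l' : R) : a <= b -> b + l' <= a + l -> l' <= l.
Proof. lra. Qed.

Lemma half_le (c e lo : R) : c - 2 * e <= lo -> e <= c / 4 -> c / 2 <= lo.
Proof. lra. Qed.

Lemma div60_le (b c : R) : 0 < b -> c <= b / 60 -> c <= b.
Proof. lra. Qed.

Section Fixed.
Variables (B : nat) (c : R) (eta sig lo : nat -> R).
Hypotheses (B1 : (1 < B)%N) (c0 : 0 < c) (cle : c <= bad1 R B / 60).
Hypotheses (etac : forall k, eta k <= c / 4)
  (ins : forall k, insertable B c (eta k) (sig k))
  (lo1 : forall k, c - 2 * eta k <= lo k) (lo2 : forall k, lo k <= c).

Lemma subI (I J : R * R) x : I.1 <= J.1 -> J.1 + J.2 <= I.1 + I.2 ->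
  inI J x -> inI I x.
Proof. by move=> h1 h2 /andP[h3 h4]; rewrite /inI (le_trans h1 h3) (le_trans h4 h2). Qed.

Lemma free_children (I : R * R) : valid B c I ->
  exists ch : nat -> R * R,
   (forall d, (d < B)%N -> [/\ valid B c (ch d), I.1 <= (ch d).1,
     (ch d).1 + (ch d).2 <= I.1 + I.2, (ch d).2 = I.2 / Nb R B &
     forall x, inI (ch d) x -> forall p q : int, 0 < q ->
       kap R B <= q%:~R ^+ 2 * I.2 -> q%:~R ^+ 2 * (ch d).2 < kap R B ->
       c <= err x p q]) /\
   forall d d' x x', d != d' -> inI (ch d) x -> inI (ch d') x' ->
     I.2 / Nb R B <= `|x - x'|.
Proof.
move=> [l0 l1 ctrl].
have [N7 c1pos c10 c01 [k0 kN]] := const_bounds R B1.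
have N0 : 0 < Nb R B by exact: lt_le_trans N7.
have Nn : (0 < 2 * B + 3)%N by rewrite addnS.
have [z Hz] := one_dangerous I.1 Nn l0 k0 kN.
set w := I.2 / Nb R B.
have w0 : 0 < w by rewrite divr_gt0.
have wE : Nb R B * w = I.2 by rewrite mulrC divfK ?gt_eqF.
have wE2 : I.2 / (2 * Nb R B) = w / 2 by rewrite /w invfM; ring.
have [e He] := one_zone I.1 z w0.
have w1 : w <= 1.
  by rewrite ler_pdivrMr// mul1r (le_trans l1)//; apply: le_trans N7; rewrite ler1n.
(* [bump e] skips the only slot e that the dangerous rational may spoil *)
pose ch (d : nat) := (I.1 + (2 * (bump e d)%:R + 1) * w, w).
have chE d : (ch d).1 + (ch d).2 = I.1 + (2 * (bump e d)%:R + 2) * w.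
  by rewrite /ch /=; ring.
have bB d : (d < B)%N -> (bump e d)%:R <= B%:R :> R.
  move=> dB; rewrite ler_nat; apply: leq_trans dB.
  by rewrite /bump; case: (e <= d)%N; rewrite ?add1n ?add0n.
have sub1 d : I.1 <= (ch d).1.
  by rewrite /ch /= lerDl mulr_ge0 ?(ltW w0)// addr_ge0// mulr_ge0 ?ler0n.
have sub2 d : (d < B)%N -> (ch d).1 + (ch d).2 <= I.1 + I.2.
  move=> /bB dB; rewrite chE lerD2l -wE ler_pM2r// /Nb natrD natrM.
  apply: lerD; last by rewrite ler_nat.
  by rewrite ler_pM2l.
have arith d x : (d < B)%N -> inI (ch d) x -> forall p q : int, 0 < q ->
    kap R B <= q%:~R ^+ 2 * I.2 -> q%:~R ^+ 2 * w < kap R B -> bad1 R B <= err x p q.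
  move=> dB xd p q q0 q1 q2; apply: (Hz x) => //.
  - exact: subI (sub1 d) (sub2 d dB) xd.
  - by rewrite -wE mulrCA mulrC ltr_pM2r.
  - rewrite wE2; apply: (He (bump e d)); first by rewrite eq_sym neq_bump.
    by move: xd; rewrite /inI chE.
have c_c1 : c <= bad1 R B by exact: div60_le.
exists ch; split.
  move=> d dB; split => //; [|exact: sub2|].
    split => //= x xd p q q0 q1.
    case: (ltP (q%:~R ^+ 2 * I.2) (kap R B)) => q2.
      exact: ctrl (subI (sub1 d) (sub2 d dB) xd) _ _ q0 q2.
    apply: le_trans (arith d x dB xd p q q0 q2 q1); apply: le_trans c_c1.
    by rewrite ler_pdivrMr// ler_peMr ?(ltW c0)// ler1n.
  by move=> x xd p q q0 q1 q2; apply: (le_trans c_c1); exact: (arith d).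
move=> d d' x x' dd' /andP[x1 x2] /andP[y1 y2].
have {dd'}jj : bump e d != bump e d' by apply: contra_neq dd'; exact: (can_inj (bumpK e)).
rewrite chE in x2; rewrite chE in y2; rewrite /ch /= in x1 y1.
exact: slots_apart w0 jj x1 x2 y1 y2.
Qed.

Lemma child_step (I : R * R) (o : option nat) : valid B c I ->
  exists F : nat -> R * R,
   (forall d, (d < B)%N -> good_child B c eta sig lo o I (F d)) /\
   forall d d' x x', (d < B)%N -> (d' < B)%N -> d != d' ->
     inI (F d) x -> inI (F d') x' -> I.2 / Nb R B <= `|x - x'|.
Proof.
move=> vI; have [ch [chP sep]] := free_children vI.
have [N7 c1pos c10 c01 [k0 kN]] := const_bounds R B1.
have N0 : 0 < Nb R B by exact: lt_le_trans N7.
have N2 : I.2 / Nb R B <= I.2 / 2.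
  have [l0 _ _] := vI.
  by rewrite ler_pM2l// lef_pV2 ?posrE//; apply: le_trans N7; rewrite ler_nat.
case: o => [k|]; last first.
  exists ch; split => [d dB|d d' x x' _ _]; last exact: sep.
  have [v s1 s2 e ar] := chP d dB; split => //; first by rewrite e.
    by rewrite e /= mulrC.
  by move=> x xd; split => // p q; exact: ar.
have step d : exists J : R * R, (d < B)%N -> 
    good_child B c eta sig lo (Some k) I J /\ forall x, inI J x -> inI (ch d) x.
  case: (ltnP d B) => dB; last by exists (0, 0).
  have [[v1 v2 v3] s1 s2 e ar] := chP d dB.
  have vch : valid B c (ch d) by [].
  have [J [J1 J2 J3 J4 J5]] := ins vch (lo1 k) (lo2 k).
  exists J => _; have JJ x : inI J x -> inI (ch d) x by exact: subI.
  have le2 : J.2 <= (ch d).2 by exact: sub_length J1 J2.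
  have lo3 : c / 2 <= lo k by exact: half_le (lo1 k) (etac k).
  split => //; split => //.
  - split => //; first exact: le_trans v2.
    move=> x xJ p q q0 q1.
    case: (ltP (q%:~R ^+ 2 * (ch d).2) (kap R B)) => q2.
      exact: v3 (JJ x xJ) _ _ q0 q2.
    by apply: (le_trans lo3); have [h _] := J5 x xJ; exact: h.
  - by split; [exact: le_trans J1|exact: le_trans s2].
  - by apply: (le_trans le2); rewrite e.
  - by rewrite /= mulrAC -mulrA -e.
  - move=> x xJ; have [h1 [p [q [q0 q1 q2]]]] := J5 x xJ; split.
      move=> p' q' q'0 q'1 q'2 /=.
      case: (ltP (q'%:~R ^+ 2 * (ch d).2) (kap R B)) => q'3.
        by apply: (le_trans (lo2 k)); apply: ar => //; exact: JJ.
      exact: h1.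
    move=> _ [<-]; exists p, q; split => //; apply: (le_trans q1).
    have [l0 _ _] := vI.
    rewrite ler_wpM2l ?sqr_ge0// e ler_pdivrMr// ler_peMr ?(ltW l0)//.
    by apply: le_trans N7; rewrite ler1n.
have [F FP] := choice step.
exists F; split => [d dB|d d' x x' dB dB' dd' xd xd']; first by have [] := FP d dB.
have [_ h] := FP d dB; have [_ h'] := FP d' dB'.
exact: sep dd' (h x xd) (h' x' xd').
Qed.

(** The tree, explored along digit sequences: the point G dg is controlled at all
    scales, and sequences that first differ at level n lead to points at
    distance at least lam n / N. *)
Lemma tree (sched : nat -> option nat) (lam : nat -> R) :
  lam 0%N = kap R B ->
  (forall n, 0 <= lam n) ->
  (forall n, lam n.+1 = factor (Nb R B) sig (sched n) * lam n) ->
  (forall k, 0 < sig k) ->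
  exists G : (nat -> nat) -> R,
   (forall dg, (forall n, (dg n < B)%N) -> exists l : nat -> R,
     [/\ l 0%N = kap R B, forall n, 0 < l n, forall n, l n.+1 <= l n / 2,
       forall n (p q : int), 0 < q -> kap R B <= q%:~R ^+ 2 * l n ->
         q%:~R ^+ 2 * l n.+1 < kap R B -> lower c lo (sched n) <= err (G dg) p q &
       forall n k, sched n = Some k -> exists p q : int,
         [/\ 0 < q, kap R B <= q%:~R ^+ 2 * l n & err (G dg) p q <= lo k + eta k]]) /\
   forall dg dg' n, (forall n, (dg n < B)%N) -> (forall n, (dg' n < B)%N) ->
     (forall j, (j < n)%N -> dg j = dg' j) -> dg n <> dg' n ->
     lam n / Nb R B <= `|G dg - G dg'|.
Proof.
move=> lam0 lamge lamS sig0.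
have [N7 c1pos c10 c01 [k0 kN]] := const_bounds R B1.
have N0 : 0 < Nb R B by exact: lt_le_trans N7.
have cs (Io : (R * R) * option nat) : exists F : nat -> R * R, valid B c Io.1 ->
   (forall d, (d < B)%N -> good_child B c eta sig lo Io.2 Io.1 (F d)) /\
   forall d d' x x', (d < B)%N -> (d' < B)%N -> d != d' ->
     inI (F d) x -> inI (F d') x' -> Io.1.2 / Nb R B <= `|x - x'|.
  case: (pselect (valid B c Io.1)) => [v|nv]; last by exists (fun=> (0, 0)).
  by have [F HF] := child_step Io.2 v; exists F.
have [F FP] := choice cs.
(* the interval reached after n digits *)
pose node := fix node (dg : nat -> nat) (n : nat) : R * R :=
  if n is n'.+1 then F (node dg n', sched n') (dg n') else (0, kap R B).
have v0 : valid B c (0, kap R B).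
  split => //=.
    by rewrite (le_trans kN)// invf_le1 ?mulr_gt0//; apply: le_trans (_ : Nb R B <= _);
      [apply: le_trans N7; rewrite ler1n|rewrite ler_peMl ?(ltW N0)// ler1n].
  move=> x _ p q q0; rewrite ltNge ler_peMl ?(ltW k0)//.
  by rewrite exprn_ege1// ler1z -gtz0_ge1.
have vn dg n : (forall n, (dg n < B)%N) -> valid B c (node dg n).
  move=> dB; elim: n => [//|n IH].
  by have [h _] := FP (node dg n, sched n) IH; have [] := h (dg n) (dB n).
have gc dg n : (forall n, (dg n < B)%N) ->
    good_child B c eta sig lo (sched n) (node dg n) (node dg n.+1).
  by move=> dB; have [h _] := FP (node dg n, sched n) (vn dg n dB); exact: h.
have lim dg : exists x, (forall n, (dg n < B)%N) -> forall n, inI (node dg n) x.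
  case: (pselect (forall n, (dg n < B)%N)) => [dB|nd]; last by exists 0.
  have [x xP] : exists x, forall n, (node dg n).1 <= x <= (node dg n).1 + (node dg n).2.
    apply: nested_intervals => n; first by have [/ltW] := vn dg n dB.
    by have [_ []] := gc dg n dB.
  by exists x.
have [G GP] := choice lim.
exists G; split.
  move=> dg dB; exists (fun n => (node dg n).2); split => //.
  - by move=> n; have [] := vn dg n dB.
  - by move=> n; have [] := gc dg n dB.
  - by move=> n; have [_ _ _ _ h] := gc dg n dB; have [] := h _ (GP dg dB n.+1).
  - by move=> n; have [_ _ _ _ h] := gc dg n dB; have [] := h _ (GP dg dB n.+1).
move=> dg dg' n dB dB' agree dn.
have same j : (j <= n)%N -> node dg j = node dg' j.
  elim: j => [//|j IH] jn /=; rewrite (IH (ltnW jn)) agree//.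
have lamle j : lam j <= (node dg j).2.
  elim: j => [|j IH]; first by rewrite lam0.
  have [_ _ _ h _] := gc dg j dB; rewrite lamS; apply: le_trans h.
  rewrite ler_wpM2l// /factor; case: (sched j) => [k|]; last by rewrite invr_ge0 ltW.
  by rewrite divr_ge0 ?ltW.
apply: (@le_trans _ _ ((node dg n).2 / Nb R B)); first by rewrite ler_pM2r ?invr_gt0.
have [_ sep] := FP (node dg n, sched n) (vn dg n dB).
apply: (sep (dg n) (dg' n)) => //; first exact/eqP.
  exact: GP dg dB n.+1.
by rewrite (same n (leqnn n)); exact: GP dg' dB' n.+1.
Qed.

End Fixed.

End Tree.

(** * Large sets of numbers with prescribed approximation quality *)

Section Family.
Variable R : realType.

(** Numbers for which, as the denominator grows, err is at least c or some [lo k]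
    with k arbitrarily large, and infinitely often at most some lo k + eta k
    with k arbitrarily large. *)
Definition special_approx (c : R) (lo eta : nat -> R) : set R :=
  [set al | (forall k0, exists Q0 : R, forall p q : int, 0 < q -> Q0 <= q%:~R ^+ 2 ->
      c <= err al p q \/ exists2 k, (k0 <= k)%N & lo k <= err al p q) /\
    (forall k0 (Q0 : R), exists2 k, (k0 <= k)%N & exists p q : int,
      [/\ 0 < q, Q0 <= q%:~R ^+ 2 & err al p q <= lo k + eta k])].

Lemma branching_lt (b : nat) : (1 < b)%N -> (2 * b + 3 < 6 * b)%N.
Proof. lia. Qed.

Lemma large_family (m : nat) : (0 < m)%N ->
  exists2 cm : R, 0 < cm & forall c, 0 < c -> c <= cm ->
  exists eta : nat -> R, (forall k, 0 < eta k <= k.+1%:R^-1) /\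
  forall lo : nat -> R, (forall k, c - 2 * eta k <= lo k <= c) ->
  ((m%:R / m.+1%:R)%:E <= HD (special_approx c lo eta))%E.
Proof.
move=> m0; pose B := (6 ^ m)%N.
have B1 : (1 < B)%N by rewrite -[1%N](exp1n m) ltn_exp2r.
have [N7 c1pos c10 c01 [k0 kN]] := const_bounds R B1.
exists (bad1 R B / 60); first by apply: divr_gt0 => //; rewrite ltr0n.
move=> c cpos cle.
have [y [by_ bx]] := bad_pair c^-1 B1.
have ins k := insertion B1 cpos cle by_ bx (ltn0Sn k).
have [es esP] := choice ins.
pose eta k := (es k).1; pose sig k := (es k).2.
exists eta; split; first by move=> k; have [-> _ -> _ _] := esP k.
move=> lo lob.
have N0 : 0 < Nb R B by exact: lt_le_trans N7.
(* beta^m = B^-(m+1), and N beta < 1 leaves room for the insertions *)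
pose beta : R := (6 ^ m.+1)%:R^-1.
have b6 : 0 < (6 ^ m.+1)%:R :> R by rewrite ltr0n expn_gt0.
have b0 : 0 < beta by rewrite invr_gt0.
have Nb1 : Nb R B * beta < 1.
  by rewrite ltr_pdivrMr// mul1r ltr_nat expnS -/B branching_lt.
have sig0 k : 0 < sig k by have [] := esP k.
have [sched [lam [lam0 lamge lamS schinf schto]]] := schedule N0 b0 Nb1 k0 sig0.
have lam_ge0 n : 0 <= lam n.
  by apply: le_trans (lamge n); rewrite mulr_ge0 ?exprn_ge0// ltW.
have [G [G1 G2]] := @tree R B c eta sig lo B1 cpos cle
  (fun k => let: And5 _ h _ _ _ := esP k in h)
  (fun k => let: And5 _ _ _ _ h := esP k in h)
  (fun k => let: conj h _ := andP (lob k) in h)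
  (fun k => let: conj _ h := andP (lob k) in h) sched lam lam0 lam_ge0 lamS sig0.
have [dg [dgB dgP]] := digits R B1.
pose C : R := (Nb R B / kap R B) ^+ m.
apply: (@HD_ge_ratio R _ (G \o dg) C).
- by rewrite exprn_gt0// divr_gt0.
- move=> u u01 /=.
  have [l [l0 lpos lS low spec]] := G1 (dg u) (fun n => dgB u n u01).
  have lmono n i : l (i + n)%N <= l n.
    elim: i => // i IH; rewrite addSn; apply: le_trans IH; apply: (le_trans (lS _)).
    by rewrite ler_pdivrMr// ler_peMr ?(ltW (lpos _))// ler1n.
  split.
    move=> j0; have [n0 hn0] := schto j0.
    exists (kap R B / l n0) => p q q0 qQ.
    have Q0 : 0 < q%:~R ^+ 2 :> R by rewrite exprn_gt0// ltr0z.
    rewrite ler_pdivrMr ?lpos// in qQ.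
    have [i Hi] : exists i, q%:~R ^+ 2 * l (i + n0)%N < kap R B.
      have [i Hi] : exists i, l (i + n0)%N < kap R B / q%:~R ^+ 2.
        apply: (@halving_small R (fun i => l (i + n0)%N)) => [i|i|].
        - exact: ltW.
        - by rewrite addSn; exact: lS.
        - by rewrite divr_gt0.
      by exists i; rewrite mulrC -ltr_pdivlMr.
    have [n [n1 n2]] := @crossing R (fun i => q%:~R ^+ 2 * l (i + n0)%N) _ i qQ Hi.
    have := low (n + n0)%N p q q0 n1 n2.
    case E: (sched (n + n0)%N) => [k|] /= h; last by left.
    by right; exists k => //; exact: (hn0 _ _ (leq_addl n n0) E).
  move=> j0 Q0; have [n0 hn0] := schto j0.
  have [n1 hn1] : exists n1, l n1 < kap R B / (`|Q0| + 1).
    apply: (@halving_small R l) => [i||]; [exact: ltW|exact: lS|].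
    by rewrite divr_gt0// ltr_wpDl.
  have [n nn [k E]] := schinf (maxn n0 n1).
  rewrite geq_max in nn; have /andP[nn0 nn1] := nn.
  exists k; first exact: (hn0 _ _ nn0 E).
  have [p [q [q0 q1 q2]]] := spec n k E; exists p, q; split => //.
  have Q1 : 0 < `|Q0| + 1 by rewrite ltr_wpDl.
  have lE : l n <= kap R B / (`|Q0| + 1).
    by apply: le_trans (ltW hn1); rewrite -(subnK nn1); exact: lmono.
  have : kap R B <= q%:~R ^+ 2 * (kap R B / (`|Q0| + 1)).
    by apply: (le_trans q1); rewrite ler_wpM2l// sqr_ge0.
  rewrite mulrA ler_pdivlMr// mulrC ler_pM2r//; apply: le_trans.
  by rewrite (le_trans (ler_norm _))// lerDl.
move=> u v u01 v01 /=.
have [->|uv] := eqVneq u v.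
  by rewrite subrr normr0 expr0n /= mulr_ge0 ?exprn_ge0// divr_ge0// ltW.
have [n [n1 n2 n3]] := dgP u v u01 v01 uv.
have sep := G2 _ _ n (fun n => dgB u n u01) (fun n => dgB v n v01) n1 n2.
have B0 : 0 < B%:R ^+ n :> R by rewrite exprn_gt0// ltr0n expn_gt0.
have uvB : `|u - v| <= (B%:R ^+ n)^-1 by rewrite -[leRHS]mul1r ler_pdivlMr.
have bB : (B%:R ^+ n)^-1 ^+ m.+1 = (beta ^+ n) ^+ m.
  rewrite /beta /B !exprVn; congr (_^-1).
  rewrite !natrX -!exprM; congr (_ ^+ _).
  by rewrite ?mulnA [RHS]mulnC [in RHS](mulnC m.+1) ?mulnA.
apply: (@le_trans _ _ ((beta ^+ n) ^+ m)).
  by rewrite -bB lerXn2r// nnegrE invr_ge0 ltW.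
rewrite /C -exprMn lerXn2r ?nnegrE ?exprn_ge0 ?(ltW b0)//.
  by rewrite mulr_ge0// divr_ge0// ltW.
have : kap R B * beta ^+ n / Nb R B <= `|G (dg u) - G (dg v)|.
  by apply: le_trans sep; rewrite ler_pM2r ?invr_gt0//.
rewrite ler_pdivrMr// mulrC -ler_pdivlMr// => h; apply: (le_trans h).
by rewrite le_eqVlt; apply/orP; left; apply/eqP; ring.
Qed.

End Family.

(** * The sets of the theorem *)

Section Exact.
Variable R : realType.
Implicit Types (c al t : R).

Lemma approx_pairsP al c (p : int) (q : nat) :
  approx_pairs al c (p, q) <-> (0 < q)%N /\ err al p q < c.
Proof.
rewrite /approx_pairs /=; split => -[q0 h]; split => //.
  rewrite errE; last by rewrite ltz_nat.
  have Q0 : 0 < (q%:Z)%:~R ^+ 2 :> R by rewrite exprn_gt0// ltr0z ltz_nat.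
  by rewrite mulrC -ltr_pdivlMr.
have Q0 : 0 < (q%:Z)%:~R ^+ 2 :> R by rewrite exprn_gt0// ltr0z ltz_nat.
rewrite errE in h; last by rewrite ltz_nat.
by rewrite mulrC -ltr_pdivlMr in h.
Qed.

Lemma int_box (p : int) (M : nat) : `|p| < M%:Z ->
  exists2 i : nat, (i < 2 * M)%N & i%:Z - M%:Z = p.
Proof. by move=> h; exists (absz (p + M%:Z)); lia. Qed.

(** A set of solutions with bounded denominators is finite. *)
Lemma finite_box al c (n : nat) (S : set (int * nat)) :
  S `<=` approx_pairs al c -> (forall pq, S pq -> (pq.2 <= n)%N) -> finite_set S.
Proof.
move=> Sap Sn.
pose M := (Num.trunc (n%:R * `|al| + `|c|)).+1.
apply: (@sub_finite_set _ _ ((fun i : nat => i%:Z - M%:Z) @` `I_(2 * M) `*` `I_n.+1)).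
  move=> [p q] Spq; have /approx_pairsP [q0 e] := Sap _ Spq.
  have qn := Sn _ Spq; split => //=.
  have q1 : 1 <= (q%:Z)%:~R :> R by rewrite ler1z lez_nat.
  have e' : `|(q%:Z)%:~R * al - p%:~R| < `|c|.
    apply: (@le_lt_trans _ _ (err al p q)); first by rewrite /err ler_peMl.
    by apply: (lt_le_trans e); exact: ler_norm.
  have pM : `|p|%:~R < M%:R :> R.
    rewrite intr_norm.
    have h : `|p%:~R| <= `|(q%:Z)%:~R * al| + `|(q%:Z)%:~R * al - p%:~R|.
      have := ler_normB ((q%:Z)%:~R * al) ((q%:Z)%:~R * al - p%:~R).
      by rewrite opprB addrC subrK.
    apply: (le_lt_trans h).
    have x0 : 0 <= n%:R * `|al| + `|c| by rewrite addr_ge0// mulr_ge0.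
    have /andP[_ /le_lt_trans] := truncn_itv x0; apply.
    apply: lerD; last exact: ltW.
    by rewrite normrM ler_wpM2r// ger0_norm ?ler0z// -pmulrn ler_nat.
  rewrite pmulrn ltr_int in pM.
  exact: int_box.
by apply: finite_setX => //; exact: finite_image.
Qed.

Lemma finite_bound (S : set (int * nat)) : finite_set S ->
  exists n, forall pq, S pq -> (pq.2 <= n)%N.
Proof.
move=> /finite_seqP [s ->]; exists (\max_(x <- s) x.2)%N => pq /= pqs.
exact: leq_bigmax_seq.
Qed.

(** A rational number is approximated with err = 0 by all its representations. *)
Lemma rat_not_Exact c al : 0 < c -> Exact c al -> irrational al.
Proof.
move=> c0 [_ fin] [r _ rE].
have c2 : 0 < c / 2 by rewrite divr_gt0.
have [n nP] := finite_bound (fin _ c2).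
have : approx_pairs al (c - c / 2) (n.+1%:Z * numq r, (n.+1 * `|denq r|)%N).
  apply/approx_pairsP; split; first by rewrite muln_gt0 absz_gt0 denq_neq0.
  rewrite /err PoszM absz_denq.
  have -> : (n.+1%:Z * denq r)%:~R * al - (n.+1%:Z * numq r)%:~R = 0 :> R.
    have d0 : (denq r)%:~R != 0 :> R by rewrite intr_eq0 denq_neq0.
    rewrite -rE /ratr !intrM.
    by move: (n.+1%:Z)%:~R (numq r)%:~R (denq r)%:~R d0 => a b d d0; field.
  by rewrite normr0 mulr0; lra.
move=> /nP /=; rewrite leqNgt => /negP; apply.
by rewrite leq_pmulr// absz_gt0 denq_neq0.
Qed.

Lemma irrational_dist al (s : seq rat) : irrational al ->
  exists2 d : R, 0 < d & forall r, r \in s -> d <= `|al - ratr r|.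
Proof.
move=> ir; elim: s => [|r s [d d0 IH]]; first by exists 1.
have r0 : 0 < `|al - ratr r|.
  rewrite normr_gt0 subr_eq0; apply/eqP => e; apply: ir; exists r => //.
exists (Num.min d `|al - ratr r|); first by rewrite lt_min d0.
move=> x; rewrite inE => /predU1P[->|/IH h]; rewrite ge_min ?lexx ?orbT//.
by rewrite h.
Qed.

(** For irrational numbers it does not matter whether pairs or fractions are
    counted: if only finitely many fractions occur, they are all at distance
    at least some d > 0, which bounds the denominators of the solutions. *)
Lemma infinite_rationals al c : irrational al ->
  infinite_set (approx_pairs al c) -> infinite_set (approx_rationals al c).
Proof.
move=> ir inf fin; apply: inf; have /finite_seqP [s sE] := fin.
have [d d0 dP] := irrational_dist s ir.
apply: (@finite_box al c (Num.trunc (`|c| / d)).+1) => // -[p q] pq /=.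
have rs : (p%:~R / q%:R : rat) \in s.
  have : approx_rationals al c (p%:~R / q%:R) by exists (p, q).
  by rewrite sE.
have := dP _ rs; rewrite fmorph_div /= ratr_int ratr_nat => h.
have [q0 _] := pq; have /approx_pairsP [_ e] := pq.
rewrite errE in e; last by rewrite ltz_nat.
rewrite -pmulrn in e.
have Q1 : 1 <= q%:R :> R by rewrite ler1n.
have iv0 : 0 <= `|c| / d by rewrite divr_ge0// ltW.
have /andP[_ t1] := truncn_itv iv0.
rewrite -(ler_nat R); apply: ltW; apply: le_lt_trans t1.
rewrite ler_pdivlMr//; apply: le_trans (ler_norm c); apply: le_trans (ltW e).
rewrite expr2 -mulrA ler_wpM2l ?ler0n//; apply: (le_trans h).
by rewrite ler_peMl.
Qed.

Lemma Exact_k_level c : 0 < c -> Exact c `<=` k_level c^-1.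
Proof.
move=> c0 al E; have ir := rat_not_Exact c0 E; split => //.
have [inf fin] := E; apply/eqP; rewrite eq_le; apply/andP; split.
  apply: ge_ereal_sup => _ [k [k0 kinf] <-]; rewrite lee_fin leNgt; apply/negP => kc.
  have e0 : 0 < c - k^-1 by rewrite subr_gt0 invf_plt ?posrE.
  have := fin _ e0; rewrite subKr => f; apply: kinf; exact: finite_image.
apply: ereal_sup_ubound; exists c^-1 => //; split; first by rewrite invr_gt0.
by rewrite invrK; exact: infinite_rationals.
Qed.

Lemma k_level_sublevel (s t : R) : s < t -> k_level s `<=` k_sublevel t.
Proof. by move=> st al [ir e]; split => //; rewrite e lte_fin. Qed.

Lemma special_Exact c (lo eta : nat -> R) :
  (forall k, 0 < eta k <= k.+1%:R^-1) -> (forall k, lo k = c - 2 * eta k) ->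
  special_approx c lo eta `<=` Exact c.
Proof.
move=> eta1 loE al [low spec]; split.
  move=> /finite_bound [n nP].
  have [k _ [p [q [q0 q1 q2]]]] := spec 0%N (n.+1%:R ^+ 2).
  have qE : q = `|q|%N by rewrite gtz0_abs.
  have : approx_pairs al c (p, `|q|%N).
    apply/approx_pairsP; rewrite absz_gt0 gt_eqF// -qE; split => //.
    by apply: (le_lt_trans q2); rewrite loE; have /andP[h _] := eta1 k; lra.
  move=> /nP /=; rewrite leqNgt => /negP; apply.
  move: q1; rewrite ler_pXn2r ?nnegrE ?ler0n ?ler0z ?(ltW q0)//.
  by rewrite pmulrn ler_int {1}qE lez_nat.
move=> eps e0; have [k0 hk0] : exists k0, 2 * k0.+1%:R^-1 < eps.
  exists (Num.trunc (2 / eps)); rewrite ltr_pdivrMr// mulrC -ltr_pdivrMr//.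
  by have /andP[] := truncn_itv (ltW (divr_gt0 (ltr0n R 2) e0)).
have [Q0 HQ] := low k0.
apply: (@finite_box al (c - eps) (Num.trunc `|Q0|).+1) => // -[p q] pq /=.
have [q0 _] := pq; have /approx_pairsP [_ e] := pq.
rewrite leqNgt; apply/negP => big.
have qz : 0 < q%:Z by rewrite ltz_nat.
have Q1 : Q0 <= (q%:Z)%:~R ^+ 2.
  apply: (le_trans (ler_norm _)); have /andP[_ t1] := truncn_itv (normr_ge0 Q0).
  apply: (le_trans (ltW t1)); rewrite -pmulrn -natrX ler_nat.
  by apply: (leq_trans (ltnW big)); rewrite -{1}[q]expn1 leq_pexp2l.
have [h|[k kk h]] := HQ p q qz Q1; first by lra.
have /andP[_ h2] := eta1 k; rewrite loE in h.
have h3 : k.+1%:R^-1 <= k0.+1%:R^-1 :> R.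
  by rewrite lef_pV2 ?posrE ?ltr0n// ler_nat ltnS.
have := le_trans h2 h3; move: hk0; move: (k0.+1%:R^-1) => z hk0 h4.
lra.
Qed.

Lemma special_Exact' c (lo eta : nat -> R) :
  (forall k, 0 < eta k <= k.+1%:R^-1) -> (forall k, lo k = c) ->
  special_approx c lo eta `<=` Exact' c.
Proof.
move=> eta1 loE al [low spec]; split.
  move=> eps e0 /finite_bound [n nP].
  have [k kk [p [q [q0 q1 q2]]]] := spec (Num.trunc eps^-1) (n.+1%:R ^+ 2).
  have qE : q = `|q|%N by rewrite gtz0_abs.
  have ke : eta k < eps.
    have /andP[_ h] := eta1 k; apply: (le_lt_trans h).
    rewrite invf_plt ?posrE ?ltr0n//.
    have iv0 : 0 <= eps^-1 by rewrite invr_ge0 ltW.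
    have /andP[_ t1] := truncn_itv iv0; apply: (lt_le_trans t1).
    by rewrite ler_nat ltnS.
  have : approx_pairs al (c + eps) (p, `|q|%N).
    apply/approx_pairsP; rewrite absz_gt0 gt_eqF// -qE; split => //.
    by apply: (le_lt_trans q2); rewrite loE ltrD2l.
  move=> /nP /=; rewrite leqNgt => /negP; apply.
  move: q1; rewrite ler_pXn2r ?nnegrE ?ler0n ?ler0z ?(ltW q0)//.
  by rewrite pmulrn ler_int {1}qE lez_nat.
have [Q0 HQ] := low 0%N.
apply: (@finite_box al c (Num.trunc `|Q0|).+1) => // -[p q] pq /=.
have [q0 _] := pq; have /approx_pairsP [_ e] := pq.
rewrite leqNgt; apply/negP => big.
have qz : 0 < q%:Z by rewrite ltz_nat.
have Q1 : Q0 <= (q%:Z)%:~R ^+ 2.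
  apply: (le_trans (ler_norm _)); have /andP[_ t1] := truncn_itv (normr_ge0 Q0).
  apply: (le_trans (ltW t1)); rewrite -pmulrn -natrX ler_nat.
  by apply: (leq_trans (ltnW big)); rewrite -{1}[q]expn1 leq_pexp2l.
move: e; rewrite ltNge => /negP; apply.
by have [//|[k _]] := HQ p q qz Q1; rewrite loE.
Qed.

Lemma HD_Exact_ge (m : nat) : (0 < m)%N -> exists2 cm : R, 0 < cm &
  forall c, 0 < c -> c <= cm -> ((m%:R / m.+1%:R)%:E <= HD (@Exact R c))%E /\
    ((m%:R / m.+1%:R)%:E <= HD (@Exact' R c))%E.
Proof.
move=> m0; have [cm cm0 H] := large_family R m0; exists cm => // c c0 cle.
have [eta [eta1 E]] := H c c0 cle.
have e0 k : 0 < eta k by have /andP[] := eta1 k.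
split.
  apply: (le_trans (E (fun k => c - 2 * eta k) _)).
    by move=> k; have := e0 k => h; apply/andP; split; lra.
  by apply: HD_mono; exact: special_Exact.
apply: (le_trans (E (fun=> c) _)).
  by move=> k; have := e0 k => h; apply/andP; split; lra.
by apply: HD_mono; exact: special_Exact'.
Qed.

Lemma HD_cvg1 (T : Type) (F : set_system T) {FF : Filter F} (S : T -> set R) :
  (forall m : nat, (0 < m)%N ->
     \forall x \near F, ((m%:R / m.+1%:R)%:E <= HD (S x))%E) ->
  HD (S x) @[x --> F] --> 1%E.
Proof.
move=> H; apply/fine_cvgP; split.
  near=> x; have h1 := HD_le1 (S x).
  have h2 : ((1%:R / 2%:R)%:E <= HD (S x))%E by near: x; exact: H.
  by rewrite fin_numElt (lt_le_trans (ltNyr _) h2) (le_lt_trans h1 (ltry _)).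
apply/cvgrPdist_le => e e0.
pose m := (Num.trunc e^-1).+1.
near=> x; have h1 := HD_le1 (S x).
have h2 : ((m%:R / m.+1%:R)%:E <= HD (S x))%E by near: x; exact: H.
move: h1 h2 => /=; case: (HD (S x)) => [d| |] //=; rewrite ?lee_fin //.
move=> h1 h2; rewrite ger0_norm ?subr_ge0// lerBlDr -lerBlDl.
apply: le_trans h2; rewrite ler_pdivlMr ?ltr0n// mulrBl mul1r -natr1.
have iv0 : 0 <= e^-1 by rewrite invr_ge0 ltW.
have /andP[_ t1] := truncn_itv iv0; rewrite -/m in t1.
have : 1 <= e * m%:R by rewrite mulrC -ler_pdivrMr// mul1r ltW.
rewrite mulrDr mulr1; lra.
Unshelve. all: by end_near. Qed.

End Exact.

Theorem theorem2 (R : realType) :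
  (HD (@Exact R c) @[c --> 0^'+] --> 1%E /\
   HD (@Exact' R c) @[c --> 0^'+] --> 1%E) /\
  (HD (@k_level R t) @[t --> +oo] --> 1%E /\
   HD (@k_sublevel R t) @[t --> +oo] --> 1%E /\
   @D R t @[t --> +oo] --> 1%E).
Proof.
have level m : (0 < m)%N -> exists2 tm : R, 0 < tm &
    forall t, tm < t -> ((m%:R / m.+1%:R)%:E <= HD (@k_level R t))%E.
  move=> m0; have [cm cm0 H] := HD_Exact_ge R m0.
  exists cm^-1 => [|t tt]; first by rewrite invr_gt0.
  have t0 : 0 < t by apply: lt_trans tt; rewrite invr_gt0.
  have tv : 0 < t^-1 by rewrite invr_gt0.
  have tc : t^-1 <= cm by rewrite invf_ple ?posrE// ltW.
  have [h _] := H _ tv tc.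
  apply: (le_trans h); apply: HD_mono; rewrite -{2}[t]invrK.
  by apply: Exact_k_level; rewrite invr_gt0.
have sub : HD (@k_sublevel R t) @[t --> +oo] --> 1%E.
  apply: HD_cvg1 => m m0; have [tm tm0 H] := level m m0.
  near=> t; apply: (le_trans (H (t - 1) _)).
    by rewrite ltrBrDr; near: t; apply: nbhs_pinfty_gt; rewrite num_real.
  by apply: HD_mono; apply: k_level_sublevel; lra.
split; split; [| | |by split].
- apply: HD_cvg1 => m m0; have [cm cm0 H] := HD_Exact_ge R m0.
  near=> c.
  have c0 : 0 < c by near: c; exact: nbhs_right_gt.
  have cle : c <= cm by near: c; exact: nbhs_right_le.
  by have [h _] := H c c0 cle.
- apply: HD_cvg1 => m m0; have [cm cm0 H] := HD_Exact_ge R m0.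
  near=> c.
  have c0 : 0 < c by near: c; exact: nbhs_right_gt.
  have cle : c <= cm by near: c; exact: nbhs_right_le.
  by have [_ h] := H c c0 cle.
- apply: HD_cvg1 => m m0; have [tm tm0 H] := level m m0.
  near=> t; apply: H; near: t; apply: nbhs_pinfty_gt; exact: num_real.
Unshelve. all: by end_near. Qed.
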